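(* Let $(G,\sigma)$ be a signed graph and $k\ge2$ an integer. (1) If $G$ is $(3k-1)$-edge-connected, then $\Phi_c(G,\sigma)\le\frac{2k}{k-1}$. (2) If $G$ is $3k$-edge-connected, then $\Phi_c(G,\sigma)<\frac{2k}{k-1}$. (3) If $G$ is $(3k+1)$-edge-connected, then $\Phi_c(G,\sigma)\le\frac{4k+2}{2k-1}$.
   Context: Graphs are finite, may have multiple edges but no loops; a signed graph $(G,\sigma)$ has $\sigma:E(G)\to\{+,-\}$. For an orientation $D$ and $f:E(G)\to\mathbb{R}$, $\partial_Df(v)$ is the sum of $f$ over out-arcs at $v$ minus the sum over in-arcs. A circular $r$-flow ($r\ge2$) is a pair $(D,f)$ with $f:E(G)\to(-r,r)$ such that $|f(e)|\in[1,r-1]$ for positive edges, $|f(e)|\in[0,\frac r2-1]\cup[\frac r2+1,r)$ for negative edges, and $\partial_Df(v)=0$ at every vertex. The circular flow index $\Phi_c(G,\sigma)$ is the infimum of $r$ for which $(G,\sigma)$ admits a circular $r$-flow. *)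

(* Defs.v *)
From HB Require Import structures.
From mathcomp Require Import all_boot all_order all_algebra.
From mathcomp Require Import classical_sets reals constructive_ereal ereal.

Set Implicit Arguments.
Unset Strict Implicit.
Unset Printing Implicit Defensive.

Import Order.TTheory GRing.Theory Num.Theory.
Local Open Scope ring_scope.

(* Parallel edges are distinct elements of [edge] with the same [ends]; the
   cardinality condition excludes loops. *)
Record multigraph := Multigraph {
  vertex : finType;
  edge : finType;
  ends : edge -> {set vertex};
  card_ends : forall e : edge, #|ends e| = 2%N
}.

Inductive sign := Positive | Negative.

Definition signature (G : multigraph) := edge G -> sign.

Definition adjacent_off (G : multigraph) (F : {set edge G}) : rel (vertex G) :=
  fun u v => [exists e : edge G, (e \notin F) && (ends e == [set u; v])].

(* A graph with at most one vertex is m-edge-connected for every m. *)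
Definition edge_connected (m : nat) (G : multigraph) : Prop :=
  forall F : {set edge G}, (#|F| < m)%N ->
  forall u v : vertex G, connect (adjacent_off F) u v.

Record orientation (G : multigraph) := Orientation {
  arc_tail : edge G -> vertex G;
  arc_head : edge G -> vertex G;
  ends_orientation : forall e : edge G, ends e = [set arc_tail e; arc_head e]
}.

Definition boundary (R : realType) (G : multigraph) (D : orientation G)
    (f : edge G -> R) (v : vertex G) : R :=
  \sum_(e | arc_tail D e == v) f e - \sum_(e | arc_head D e == v) f e.

Definition circular_flow (R : realType) (G : multigraph) (sigma : signature G)
    (r : R) (D : orientation G) (f : edge G -> R) : Prop :=
  [/\ forall e, - r < f e < r,
      forall e, sigma e = Positive -> 1 <= `|f e| <= r - 1,
      forall e, sigma e = Negative ->
        0 <= `|f e| <= r / 2 - 1 \/ r / 2 + 1 <= `|f e| < r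
    & forall v, boundary D f v = 0].

(* Extended-real valued: the infimum is +oo when there is no circular r-flow
   for any r. *)
Definition circular_flow_index (R : realType) (G : multigraph)
    (sigma : signature G) : \bar R :=
  ereal_inf [set r%:E | r in [set r : R | 2 <= r /\
    exists (D : orientation G) (f : edge G -> R), circular_flow sigma r D f]]%classic.

(* Main.v *)
Require Import Defs.
From HB Require Import structures.
From mathcomp Require Import all_boot all_order all_algebra.
From mathcomp Require Import zify ring lra.
From mathcomp Require Import reals.
From mathcomp Require boolp.

(** Write [r = 2m / (m - c)] and scale a circular [r]-flow by [m - c]. Modulo [2m]
    a positive edge carries [m] plus an error, a negative edge only an error, and
    the errors lie in [[-c, c]]. So it suffices to orient [c] parallel copies of
    every edge so that the net outflow of each vertex [v] is [m] times its positive
    degree modulo [2m]; Tutte's path-flipping argument turns such a modular flow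
    into a flow.

    Such orientations are produced by the method of Lovasz, Thomassen, Wu and Zhang:
    one prescribes the net outflow [t] modulo [2m] and asks each cut [B] to have
    at least [2m - 2 + |t(B)|] edges, [|t(B)|] being the distance of [t(B)] to
    [2m Z]. A root outside the graph with [O] outgoing and [I] incoming
    arcs, [min O I < m] and [max O I < 2m], may contribute to the cuts; its arcs are
    pure bookkeeping and can be added, deleted or moved. A nontrivial tight set is
    contracted and then solved inside with the rest as the new root. If there is
    none, every nontrivial cut has two edges to spare, so an edge can be oriented
    and deleted as soon as this is harmless at its two ends: it is when the
    residues of the ends have opposite signs, and if all residues are positive, new
    arcs from a vertex to the root bring its residue to [m], which has both signs.
    A vertex of residue [0] is split off.

    A [lambda]-edge-connected graph has cuts of [c lambda] edges. Parts (1) and (3)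
    take [(c, m) = (2, 2k)] and [(4, 4k + 2)]. In part (2), two root arcs in each
    direction at every vertex pay for [m = ck + 2] once [c] exceeds twice the
    number of vertices, and [m / c > k] makes the inequality strict. *)

Set Implicit Arguments.
Unset Strict Implicit.
Unset Printing Implicit Defensive.

Import Order.TTheory GRing.Theory Num.Theory.

(** The goals it serves are linear in the indicators, so these may be generalised to arbitrary
    naturals, which spares [lia] the case splits. *)
Ltac abstract_bools := repeat match goal with
  |- context [nat_of_bool ?b] => move: (nat_of_bool b) => ? end.

(** * Modular orientations and rooted cut conditions *)

Section ModuloOrientation.

Variables (T : finType) (m : nat).
Hypothesis m_gt1 : 1 < m.

Implicit Types (A B C : {set T}) (w x : T -> T -> nat) (o i : T -> nat).
Implicit Types (t b : T -> int) (u v a : T).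

Definition cong (y z : int) : Prop := exists j : int, (y = z + (2 * m)%:Z * j)%R.

Definition netflow A x u : int := (\sum_(v in A) ((x u v)%:Z - (x v u)%:Z))%R.

(** [x u v] is the number of copies of the edge [uv] directed from [u] to [v]. *)
Definition orientable A w b : Prop :=
  exists2 x, {in A &, forall u v, u != v -> x u v + x v u = w u v}
           & {in A, forall u, cong (netflow A x u) (b u)}.

Definition cut A w B := \sum_(u in B) \sum_(v in A :\: B) w u v.

Definition weight A w o i B := cut A w B + \sum_(u in B) (o u + i u).

(* [p] is the number of spare edges beyond [2m - 2 + |s|]. *)
Definition slack p A w o i t B : Prop :=
  exists2 s : int, cong (\sum_(u in B) t u)%R s
                 & `|s| + 2 * m + p <= weight A w o i B + 2.

(* [o u] and [i u] count the arcs from the root to [u] and from [u] to the root;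
   [t u] is the prescribed net outflow of [u], arcs to the root included. The vertex
   [v0] may have a small degree if its residue is [0]. *)
Record certified A w o i t v0 : Prop := Certified {
  cert_sym : forall u v, w u v = w v u;
  cert_diag : forall u, w u u = 0;
  cert_parity : {in A, forall u,
    exists j : int, (t u + (\sum_(v in A) w u v + o u + i u)%:Z = 2 * j)%R};
  cert_total : cong (\sum_(u in A) t u + (\sum_(u in A) o u)%:Z)%R
                    (\sum_(u in A) i u)%:Z;
  cert_min : minn (\sum_(u in A) o u) (\sum_(u in A) i u) < m;
  cert_max : maxn (\sum_(u in A) o u) (\sum_(u in A) i u) < 2 * m;
  cert_cut : forall B, B \subset A -> B != set0 -> B != A ->
    slack 0 A w o i t B \/ B = [set v0] /\ cong (t v0) 0
}.

Lemma cong_refl y : cong y y.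
Proof. by exists 0%R; lia. Qed.

Lemma congD y y' z z' : cong y z -> cong y' z' -> cong (y + y')%R (z + z')%R.
Proof. by move=> [j ->] [j' ->]; exists (j + j')%R; lia. Qed.

Lemma cong_trans y z z' : cong y z -> cong z z' -> cong y z'.
Proof. by move=> [j ->] [j' ->]; exists (j + j')%R; lia. Qed.

(** If [s = I - O], then [O + I - |s|] is twice the minimum, at most [2m - 2]. Otherwise
    [|s| >= 2m - |I - O|], and [O + I + |I - O|] is twice the maximum, at most [4m - 2]. So the root
    has no more arcs than a tight set of its residue would have. *)
Lemma root_bound (O I : nat) (s : int) :
  minn O I < m -> maxn O I < 2 * m -> cong s (I%:Z - O%:Z)%R ->
  O + I + 2 <= 2 * m + `|s|.
Proof.
move=> hmin hmax [j hs].
have [j0 | [j1 | j1]] : (j = 0 \/ 1 <= j \/ j <= -1)%R by lia.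
- by move: hs; rewrite j0; lia.
- have : ((2 * m)%:Z <= (2 * m)%:Z * j)%R by nia.
  by move: hs; set q := ((2 * m)%:Z * j)%R; lia.
- have : ((2 * m)%:Z * j <= - (2 * m)%:Z)%R by nia.
  by move: hs; set q := ((2 * m)%:Z * j)%R; lia.
Qed.

Lemma sum_eq_nat (A : {set T}) a : \sum_(u in A) (u == a : nat) = (a \in A).
Proof.
case: (boolP (a \in A)) => aA.
  by rewrite (bigD1 a) //= eqxx big1 // => u /andP[_ /negbTE ->].
by rewrite big1 // => u uA; case: eqP => // ua; rewrite -ua uA in aA.
Qed.

Lemma sum_andb_eq A (c : bool) a : \sum_(u in A) (c && (u == a) : nat) = c && (a \in A).
Proof. by case: c => /=; [apply: sum_eq_nat | apply: big1]. Qed.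

Lemma sum_Posz A (f : T -> nat) :
  (\sum_(u in A) (f u)%:Z = (\sum_(u in A) f u)%N%:Z)%R.
Proof. by rewrite (big_morph Posz PoszD erefl). Qed.

Definition edgew a a' u v : nat :=
  ((u == a) && (v == a')) + ((u == a') && (v == a)).

Lemma edgew_sym a a' u v : edgew a a' u v = edgew a a' v u.
Proof. by rewrite /edgew addnC [(u == a') && _]andbC [(u == a) && _]andbC. Qed.

Lemma cutD A w w' B : cut A (fun u v => w u v + w' u v) B = cut A w B + cut A w' B.
Proof. by rewrite /cut -big_split; apply: eq_bigr => u _; rewrite big_split. Qed.

Lemma eq_cut A w w' B : (forall u v, w u v = w' u v) -> cut A w B = cut A w' B.
Proof. by move=> e; apply: eq_bigr => u _; apply: eq_bigr => v _. Qed.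

Lemma cut_edgew A a a' B : a \in A -> a' \in A -> B \subset A ->
  cut A (edgew a a') B = (a \in B) (+) (a' \in B).
Proof.
move=> aA a'A sBA.
have S c c' : \sum_(u in B) \sum_(v in A :\: B) ((u == c) && (v == c') : nat)
   = (c' \in A :\: B) && (c \in B).
  under eq_bigr do rewrite sum_andb_eq andbC.
  exact: sum_andb_eq.
rewrite /cut /edgew.
under eq_bigr do rewrite big_split.
by rewrite big_split /= !S !inE aA a'A; case: (a \in B); case: (a' \in B).
Qed.

Lemma sum_edgew A a a' u : a \in A -> a' \in A ->
  \sum_(v in A) edgew a a' u v = (u == a) + (u == a').
Proof.
by move=> aA a'A; rewrite big_split /= !sum_andb_eq aA a'A !andbT.
Qed.

Lemma weightC A w o i B : (forall u v, w u v = w v u) -> B \subset A ->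
  weight A w o i B + weight A w o i (A :\: B) =
  2 * cut A w B + (\sum_(u in A) o u + \sum_(u in A) i u).
Proof.
move=> sym sBA; rewrite /weight.
have -> : cut A w (A :\: B) = cut A w B.
  rewrite /cut exchange_big /= setDDr setDv set0U (setIidPr sBA).
  by apply: eq_bigr => u _; apply: eq_bigr => v _; rewrite sym.
have -> : \sum_(u in A) o u + \sum_(u in A) i u =
    \sum_(u in B) (o u + i u) + \sum_(u in A :\: B) (o u + i u).
  by rewrite -big_split (big_setID B) /= (setIidPr sBA).
by lia.
Qed.

Lemma sym_sum_even w B : (forall u v, w u v = w v u) -> (forall u, w u u = 0) ->
  exists k, \sum_(u in B) \sum_(v in B) w u v = 2 * k.
Proof.
move=> sym diag; pose lt u v := enum_rank u < enum_rank v.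
exists (\sum_(u in B) \sum_(v in B) lt u v * w u v).
have -> : \sum_(u in B) \sum_(v in B) w u v =
    \sum_(u in B) \sum_(v in B) lt u v * w u v
    + \sum_(u in B) \sum_(v in B) lt v u * w u v.
  rewrite -big_split; apply: eq_bigr => u _; rewrite -big_split.
  apply: eq_bigr => v _; rewrite /= -mulnDl /lt.
  have [<-|uv] := eqVneq u v; first by rewrite diag muln0.
  have : nat_of_ord (enum_rank u) != enum_rank v.
    by apply: contra_neq uv => /val_inj/enum_rank_inj.
  by case: ltngtP => // _ _; rewrite ?mul1n.
rewrite [X in _ + X]exchange_big mul2n -addnn; congr addn.
by apply: eq_bigr => u _; apply: eq_bigr => v _; rewrite sym.
Qed.

(** The parity condition passes from vertices to sets because edges inside [B] are counted twice. *)
Lemma parity_weight A w o i t v0 B : certified A w o i t v0 -> B \subset A ->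
  exists j : int, (\sum_(u in B) t u + (weight A w o i B)%:Z = 2 * j)%R.
Proof.
move=> [sym diag par _ _ _ _] sBA.
have [k hk] := sym_sum_even B sym diag.
have hdeg : \sum_(u in B) \sum_(v in A) w u v = cut A w B + 2 * k.
  rewrite -hk /cut -big_split; apply: eq_bigr => u _ /=.
  by rewrite (big_setID B) /= (setIidPr sBA) addnC.
have [j hj] : exists j : int, (\sum_(u in B)
    (t u + (\sum_(v in A) w u v + o u + i u)%:Z) = 2 * j)%R.
  apply: (big_ind (fun z : int => exists j : int, (z = 2 * j)%R)).
  - by exists 0%R.
  - by move=> _ _ [j ->] [j' ->]; exists (j + j')%R; lia.
  - by move=> u uB; apply: par; apply: (subsetP sBA).
have {}hj : (\sum_(u in B) t u +
    (\sum_(u in B) (\sum_(v in A) w u v + o u + i u))%N%:Z = 2 * j)%R.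
  by rewrite -sum_Posz -big_split.
have hw : \sum_(u in B) (\sum_(v in A) w u v + o u + i u) = weight A w o i B + 2 * k.
  rewrite /weight !big_split /= hdeg; lia.
by exists (j - k%:Z)%R; lia.
Qed.

(** Parity rules out exactly one spare edge, so failing slack 2 forces equality. A representative
    with [|s| > m] could be shifted by [2m] towards 0, which lowers [|s|] by at least 2 and would
    give slack 2. *)
Lemma slack_dichotomy A w o i t v0 B : certified A w o i t v0 -> B \subset A ->
  slack 0 A w o i t B -> ~ slack 2 A w o i t B ->
  exists s : int, [/\ cong (\sum_(u in B) t u)%R s, `|s| <= m &
    weight A w o i B + 2 = 2 * m + `|s|].
Proof.
move=> cert sBA [s hs le] nsl; exists s; split=> //; last first.
  have [j hj] := parity_weight cert sBA; have [j' hj'] := hs.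
  have [?|ge] := leqP (weight A w o i B + 2) (2 * m + `|s|); first by lia.
  case: nsl; exists s => //; have : weight A w o i B + 2 != 2 * m + `|s| + 1.
    apply/eqP => e; move: hj; rewrite hj'; lia.
  lia.
rewrite leqNgt; apply/negP => gt; case: nsl.
have [sp|sn] : (0 < s \/ s < 0)%R by lia.
  exists (s - (2 * m)%:Z)%R; last by lia.
  by apply: cong_trans hs _; exists 1%R; lia.
exists (s + (2 * m)%:Z)%R; last by lia.
by apply: cong_trans hs _; exists (- 1)%R; lia.
Qed.

Lemma sum_upd B (f g : T -> nat) a k : (forall u, f u = g u + (u == a) * k) ->
  \sum_(u in B) f u = \sum_(u in B) g u + (a \in B) * k.
Proof.
move=> e; rewrite -sum_eq_nat big_distrl -big_split.
by apply: eq_bigr => u _; rewrite e.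
Qed.

Lemma sum_updz B (f g : T -> int) a (k : int) :
  (forall u, f u = g u + (u == a : nat)%:Z * k)%R ->
  (\sum_(u in B) f u = \sum_(u in B) g u + (a \in B : nat)%:Z * k)%R.
Proof.
move=> e; rewrite -sum_eq_nat -sum_Posz big_distrl -big_split /=.
by apply: eq_bigr => u _; rewrite e.
Qed.

(** * Elementary operations on orientations *)

Definition arc a a' u v : nat := (u == a) && (v == a').

Lemma netflowD A x y u :
  netflow A (fun p q => x p q + y p q) u = (netflow A x u + netflow A y u)%R.
Proof. by rewrite /netflow -big_split; apply: eq_bigr => v _ /=; lia. Qed.

Lemma eq_netflow A x y : (forall p q, x p q = y p q) -> forall u, netflow A x u = netflow A y u.
Proof. by move=> e u; apply: eq_bigr => v _; rewrite !e. Qed.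

Lemma netflow_arc A a a' u : a \in A -> a' \in A ->
  netflow A (arc a a') u = ((u == a : nat)%:Z - (u == a' : nat)%:Z)%R.
Proof.
move=> aA a'A; rewrite /netflow sumrB !sum_Posz /arc.
rewrite sum_andb_eq a'A andbT; congr (_ - _%:Z)%R.
by under eq_bigr do rewrite andbC; rewrite sum_andb_eq aA andbT.
Qed.

Lemma orientable_del A w w' b b' a a' : a \in A -> a' \in A ->
  (forall u v, w u v = w' u v + edgew a a' u v) ->
  (forall u, b u = b' u + (u == a : nat)%:Z - (u == a' : nat)%:Z)%R ->
  orientable A w' b' -> orientable A w b.
Proof.
move=> aA a'A hw hb [x hx hn].
exists (fun u v => x u v + arc a a' u v) => [u v uA vA uv|u uA].
  by rewrite hw -hx // /edgew /arc [(v == a) && _]andbC addnACA.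
rewrite netflowD netflow_arc // hb -addrA.
by apply: congD (hn u uA) _; exact: cong_refl.
Qed.

Lemma orientable_ext A w w' b b' : (forall u v, w u v = w' u v) ->
  (forall u, cong (b' u) (b u)) ->
  orientable A w' b' -> orientable A w b.
Proof.
move=> hw hb [x hx hn]; exists x => [u v uA vA uv|u uA]; first by rewrite hw hx.
exact: cong_trans (hn u uA) (hb u).
Qed.

(** Some copy of [cc'] is used in one direction, by symmetry from [c] to [c']. Rerouting it along
    [c], [a], [c'] leaves every net outflow unchanged. *)
Lemma orientable_lift A w w0 b a c c' : a \in A -> c \in A -> c' \in A ->
  a != c -> a != c' -> c != c' ->
  (forall u v, w u v = w0 u v + edgew a c u v + edgew a c' u v) ->
  orientable A (fun u v => w0 u v + edgew c c' u v) b -> orientable A w b.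
Proof.
move=> aA cA c'A ac ac' cc' hw [x hx hn].
wlog x_gt0 : c c' cA c'A ac ac' cc' hw hx / 0 < x c c'.
  move=> H; have [|x0] := posnP (x c c'); last exact: (H c c').
  move=> x0; apply: (H c' c) => //; first by rewrite eq_sym.
  - by move=> u v; rewrite hw addnAC.
  - by move=> u v uA vA uv; rewrite hx // /edgew [X in _ + X]addnC.
  by have := hx _ _ cA c'A cc'; rewrite x0 /edgew !eqxx add0n => ->; rewrite addn_gt0 orbT.
pose y u v := x u v - arc c c' u v.
have xy u v : x u v = y u v + arc c c' u v.
  rewrite /y /arc subnK //; case: (u =P c) => [->|] //; case: (v =P c') => [->|] //=.
exists (fun u v => y u v + (arc c a u v + arc a c' u v)) => [u v uA vA uv|u uA].
  have := hx _ _ uA vA uv; rewrite hw !xy /edgew /arc ![(v == _) && _]andbC.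
  move: (y u v) (y v u) (w0 u v) => p q r.
  by abstract_bools; clear; lia.
have := hn _ uA; rewrite (eq_netflow A xy).
rewrite !netflowD !netflow_arc //.
by apply: cong_trans; exists 0%R; abstract_bools; clear; lia.
Qed.

Lemma orientable_rev A w b : (forall u v, w u v = w v u) ->
  orientable A w (fun u => - b u)%R -> orientable A w b.
Proof.
move=> sym [x hx hn]; exists (fun u v => x v u) => [u v uA vA uv|u uA].
  by rewrite sym -hx // eq_sym.
have [j hj] := hn u uA; exists (- j)%R.
have -> : netflow A (fun u v => x v u) u = (- netflow A x u)%R.
  by rewrite /netflow -sumrN; apply: eq_bigr => v _; rewrite opprB.
by rewrite hj; lia.
Qed.

(** * Base case: at most two vertices *)

Lemma sum_set2 (R : nmodType) (F : T -> R) a a' : a != a' ->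
  (\sum_(u in [set a; a']) F u = F a + F a')%R.
Proof. by move=> aa'; rewrite big_setU1 ?inE ?aa' // big_set1. Qed.

Lemma weight_pair w o i a a' : a != a' ->
  weight [set a; a'] w o i [set a] = w a a' + o a + i a.
Proof.
move=> aa'; rewrite /weight /cut !big_set1.
rewrite (_ : [set a; a'] :\: [set a] = [set a']) ?big_set1 ?addnA //.
apply/setP => u; rewrite !inE; have [->|] := eqVneq u a; last by [].
by rewrite (negbTE aa').
Qed.

Lemma orientable_pair w b a a' (n : nat) : a != a' -> (forall u v, w u v = w v u) ->
  n <= w a a' -> cong (n%:Z + n%:Z - (w a a')%:Z)%R (b a) -> cong (b a + b a')%R 0 ->
  orientable [set a; a'] w b.
Proof.
move=> aa' sym hn hc ht; set e := w a a' in hn hc *.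
have a'a : a' != a by rewrite eq_sym.
pose x u v := if u == a then n else e - n.
exists x => [u v|u].
  rewrite !inE => /orP[]/eqP-> /orP[]/eqP->; rewrite ?eqxx // /x ?eqxx ?(negbTE a'a).
    by rewrite subnKC.
  by rewrite subnK // sym.
have net c c' : c != c' -> forall u, netflow [set c; c'] x u =
    (((x u c)%:Z - (x c u)%:Z) + ((x u c')%:Z - (x c' u)%:Z))%R.
  by move=> cc' v; rewrite /netflow sum_set2.
rewrite !inE net // => /orP[]/eqP->; rewrite /x !eqxx (negbTE a'a).
  by apply: cong_trans hc; exists 0%R; lia.
move: hc ht => [j hj] [j' hj']; exists (- j - j')%R; lia.
Qed.

Lemma half_int (z : int) (e : nat) : (`|z| <= e)%N ->
  (exists j : int, z + e%:Z = 2 * j)%R ->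
  exists2 n, n <= e & (n%:Z + n%:Z - e%:Z = z)%R.
Proof. by move=> ze [j hj]; exists `|j|; lia. Qed.

Lemma orientable_two A w o i t v0 a a' : certified A w o i t v0 -> a != a' ->
  A = [set a; a'] -> orientable A w (fun u => t u - (i u)%:Z + (o u)%:Z)%R.
Proof.
move=> [sym diag par tot hmin hmax hcut] aa' Aa.
have ne c : [set c] != A.
  by apply/eqP => e; have := cards2 a a'; rewrite -Aa -e cards1 aa'.
have sub c : c \in A -> [set c] \subset A by rewrite sub1set.
have n0 c : [set c] != set0 :> {set T} by apply/set0Pn; exists c; rewrite inE.
have aA : a \in A by rewrite Aa !inE eqxx.
have a'A : a' \in A by rewrite Aa !inE eqxx orbT.
have ca := hcut _ (sub _ aA) (n0 _) (ne _).
have ca' := hcut _ (sub _ a'A) (n0 _) (ne _).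
have [ja pa] := par _ aA; have [ja' pa'] := par _ a'A.
move: pa pa' tot hmin hmax ca ca'.
rewrite /slack !Aa ![\sum_(u in [set a; a']) _]big_setU1 ?inE ?aa' //= !big_set1.
rewrite sum_set2 // !diag (sym a' a) weight_pair // setUC weight_pair 1?eq_sym //.
rewrite (sym a' a) => pa pa' [jt ht] hmin hmax ca ca'.
suff [n ne' hn] : exists2 n, n <= w a a' &
    cong (n%:Z + n%:Z - (w a a')%:Z)%R (t a - (i a)%:Z + (o a)%:Z)%R.
  rewrite setUC; apply: orientable_pair hn _ => //; exists jt; lia.
case: ca ca' => [[s1 [j1 h1] le1]|[/set1_inj av0 [j0 h0]]]
                [[s2 [j2 h2] le2]|[/set1_inj av0' [j0' h0']]].
(* Adding the two cut bounds and applying [root_bound] gives [w a a' >= m - 1]. By parity, the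
   number of arcs from [a] to [a'] only matters modulo [m], so a remainder modulo [m] will do. *)
- have hr : cong (s1 + s2)%R ((i a + i a')%:Z - (o a + o a')%:Z)%R.
    by exists (jt - j1 - j2)%R; lia.
  have := root_bound hmin hmax hr => hb.
  pose q : int := (ja - (i a)%:Z)%R; exists `|(q %% m)%Z|.
    have := ltz_pmod q (ltnW m_gt1 : (0 < m%:Z)%R); lia.
  have q0 : (0 <= (q %% m)%Z)%R by apply: modz_ge0; lia.
  rewrite (gez0_abs q0).
  by exists (- (q %/ m)%Z)%R; have := divz_eq q m; rewrite /q; lia.
(* Here [a'] is the exceptional vertex of residue 0. The cut bound at [a] and [root_bound] give
   [w a a' >= o a' + i a'], enough edges to balance the root arcs at [a'] exactly. *)
- have hr : cong s1 ((i a + i a')%:Z - (o a + o a')%:Z)%R.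
    by move: h0'; rewrite -av0' => h0'; exists (jt - j1 - j0')%R; lia.
  have := root_bound hmin hmax hr => hb.
  have [||n n1 n2] := @half_int ((i a')%:Z - (o a')%:Z)%R (w a a').
  + by lia.
  + move: h0'; rewrite -av0' => h0'; exists (ja' - (o a')%:Z - m%:Z * j0')%R; lia.
  exists n => //; rewrite n2; move: h0'; rewrite -av0' => h0'.
  by exists (j0' - jt)%R; lia.
- have hr : cong s2 ((i a + i a')%:Z - (o a + o a')%:Z)%R.
    by move: h0; rewrite -av0 => h0; exists (jt - j2 - j0)%R; lia.
  have := root_bound hmin hmax hr => hb.
  have [||n n1 n2] := @half_int ((o a)%:Z - (i a)%:Z)%R (w a a').
  + by lia.
  + move: h0; rewrite -av0 => h0; exists (ja - (i a)%:Z - m%:Z * j0)%R; lia.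
  exists n => //; rewrite n2; move: h0; rewrite -av0 => h0.
  by exists (- j0)%R; lia.
- by rewrite av0 av0' eqxx in aa'.
Qed.

Lemma orientable_small A w o i t v0 : certified A w o i t v0 -> #|A| <= 2 ->
  orientable A w (fun u => t u - (i u)%:Z + (o u)%:Z)%R.
Proof.
move=> cert A_le2; have [A0|A2|A1] := ltngtP #|A| 1.
- move: A0; rewrite ltnS leqn0 cards_eq0 => /eqP->.
  by exists (fun _ _ => 0) => [u|u]; rewrite inE.
- have : #|A| == 2 by rewrite eqn_leq A_le2.
  case/cards2P => a [a' [aa' Aa]].
  exact: orientable_two cert aa' Aa.
- have /cards1P[a Aa] : #|A| == 1 by rewrite A1.
  exists (fun _ _ => 0) => [u v|u].
    by rewrite Aa !inE => /eqP-> /eqP->; rewrite eqxx.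
  rewrite {1}Aa inE => /eqP->; rewrite /netflow Aa big_set1 subrr.
  have [j] := cert_total cert; rewrite Aa !big_set1 => hj.
  by exists (- j)%R; lia.
Qed.

(** The outside of a tight set is an admissible root. Either [|O - I| = |s|], and the two numbers
    are [m - 1] and [m - 1 + |s|], or [|O - I| = 2m - |s|], and they are [2m - 1] and [|s| - 1]. *)
Lemma root_tight (O I : nat) (s : int) : `|s| <= m -> O + I + 2 = 2 * m + `|s| ->
  cong (O%:Z - I%:Z)%R (- s)%R -> minn O I < m /\ maxn O I < 2 * m.
Proof.
move=> sm hOI [j hj].
have [j0 | [j1 | j1]] : (j = 0 \/ 1 <= j \/ j <= -1)%R by lia.
- by move: hj; rewrite j0; lia.
- have : ((2 * m)%:Z <= (2 * m)%:Z * j)%R by nia.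
  have : (j = 1 \/ (2 * m)%:Z * 2 <= (2 * m)%:Z * j)%R by nia.
  move: hj; set q := ((2 * m)%:Z * j)%R => hj.
  by case=> [j1' _|]; [move: hj; rewrite /q j1' | ]; lia.
- have : ((2 * m)%:Z * j <= - (2 * m)%:Z)%R by nia.
  have : (j = -1 \/ (2 * m)%:Z * j <= - (2 * m)%:Z * 2)%R by nia.
  move: hj; set q := ((2 * m)%:Z * j)%R => hj.
  by case=> [j1' _|]; [move: hj; rewrite /q j1' | ]; lia.
Qed.

Lemma distribute B (f : T -> nat) n : n <= \sum_(u in B) f u ->
  exists2 y : T -> nat, (forall u, y u <= f u) & \sum_(u in B) y u = n.
Proof.
elim: n => [_|n IHn lt_n]; first by exists (fun=> 0) => //; rewrite big1.
have [y yf hy] := IHn (ltnW lt_n).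
have [u uB yu] : exists2 u, u \in B & y u < f u.
  apply/exists_inP; apply: contraLR lt_n => /exists_inPn H.
  by rewrite -leqNgt -hy; apply: leq_sum => u /H; rewrite -leqNgt.
exists (fun v => y v + (v == u) * 1) => [v|].
  by rewrite muln1; case: eqP => [->|]; rewrite ?addn1 ?addn0.
by rewrite (@sum_upd B _ y u 1) // uB hy addn1.
Qed.

(** * Contraction of a tight set *)

Section Contraction.

Variables (A B : {set T}) (r : T).
Hypotheses (sBA : B \subset A) (rB : r \in B).

Let pi u := if u \in B then r else u.
Let A1 := r |: (A :\: B).
Let pre C := [set p in A | pi p \in C].

Lemma sum_pre (R : nmodType) (F : T -> R) C :
  (\sum_(u in C) \sum_(p in A | pi p == u) F p = \sum_(p in pre C) F p)%R.
Proof.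
rewrite [RHS](partition_big pi (mem C)) /=; last by move=> p; rewrite inE => /andP[].
apply: eq_bigr => u uC; apply: eq_bigl => p; rewrite !inE.
by case: eqP => [->|]; rewrite ?andbF // uC !andbT.
Qed.

Lemma pi_A1 p : p \in A -> pi p \in A1.
Proof.
move=> pA; rewrite /pi; case: (boolP (p \in B)) => pB; first exact: setU11.
by rewrite !inE pA pB orbT.
Qed.

Lemma pre_subset C : pre C \subset A.
Proof. by apply/subsetP => p; rewrite inE => /andP[]. Qed.

Lemma preT : pre A1 = A.
Proof. by apply/setP => p; rewrite inE; case: (boolP (p \in A)) => //= /pi_A1. Qed.

Lemma preD C : pre (A1 :\: C) = A :\: pre C.
Proof.
apply/setP => p; rewrite [LHS]inE !in_setD [p \in pre C]inE.
case: (boolP (p \in A)) => [pA|]; last by rewrite andbF.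
by rewrite (pi_A1 pA) !andbT.
Qed.

Lemma mem_pre p C : p \in A1 -> (p \in pre C) = (p \in C).
Proof.
rewrite in_setU1 in_setD [RHS]/= inE /pi.
by case/orP=> [/eqP->|/andP[/negbTE-> ->]] //; rewrite rB (subsetP sBA _ rB).
Qed.

Lemma pre_notin C : C \subset A1 -> r \notin C -> pre C = C.
Proof.
move=> sC rC; apply/setP => p; rewrite inE /pi.
case: (boolP (p \in B)) => [pB|pB].
  rewrite (negbTE rC) andbF; apply/esym/negbTE; apply: contra rC => pC.
  by have := subsetP sC _ pC; rewrite !inE pB /= orbF => /eqP <-.
case: (boolP (p \in C)) => pC; rewrite ?andbF // andbT.
by have := subsetP sC _ pC; rewrite !inE (negbTE pB) /= => /orP[/eqP p_r|//]; rewrite -p_r pC in rC.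
Qed.

Definition contract_w w u v :=
  if u == v then 0 else \sum_(p in A | pi p == u) \sum_(q in A | pi q == v) w p q.

Lemma cut_contract w C : C \subset A1 -> cut A1 (contract_w w) C = cut A w (pre C).
Proof.
move=> sC; rewrite /cut -preD -sum_pre; apply: eq_bigr => u uC.
under [RHS]eq_bigr do rewrite -sum_pre.
rewrite exchange_big; apply: eq_bigr => v; rewrite inE => /andP[vC _].
by rewrite /contract_w; case: eqP vC => // <-; rewrite uC.
Qed.

(** Cuts of the contraction are the cuts of [A] that do not split [B], with the same weight and the
    same residue. *)
Lemma certified_contract w o i t v0 : 1 < #|B| -> certified A w o i t v0 ->
  certified A1 (contract_w w) (fun u => \sum_(p in A | pi p == u) o p)
    (fun u => \sum_(p in A | pi p == u) i p)
    (fun u => \sum_(p in A | pi p == u) t p)%R v0.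
Proof.
move=> B2 cert; have [sym diag par tot hmin hmax hcut] := cert.
set o1 := (fun u => \sum_(p in A | pi p == u) o p).
set i1 := (fun u => \sum_(p in A | pi p == u) i p).
have hwt C : C \subset A1 ->
    weight A1 (contract_w w) o1 i1 C = weight A w o i (pre C).
  by move=> sC; rewrite /weight cut_contract // !big_split /= /o1 /i1 !sum_pre.
split.
- move=> u v; rewrite /contract_w eq_sym; case: eqP => // _.
  by rewrite exchange_big; apply: eq_bigr => p _; apply: eq_bigr => q _; rewrite sym.
- by move=> u; rewrite /contract_w eqxx.
- move=> u uA1; have s1 : [set u] \subset A1 by rewrite sub1set.
  have [j hj] := parity_weight cert (pre_subset [set u]).
  exists j; rewrite -hj -hwt // -sum_pre big_set1 /weight /cut !big_set1.
  by rewrite [in LHS](big_setD1 u) //= {1}/contract_w eqxx add0n addnA.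
- by rewrite /o1 /i1 !sum_pre preT.
- by rewrite /o1 /i1 !sum_pre preT.
- by rewrite /o1 /i1 !sum_pre preT.
move=> C sC C0 CA1.
have [||sl|[eC ct]] := hcut _ (pre_subset C).
- case/set0Pn: C0 => p pC; apply/set0Pn; exists p.
  by rewrite mem_pre // (subsetP sC).
- apply: contra CA1 => /eqP e; rewrite eqEsubset sC; apply/subsetP => p pA1.
  rewrite -mem_pre // e; move: pA1; rewrite !inE => /orP[/eqP->|/andP[]//].
  exact: (subsetP sBA).
- by left; case: sl => s hs le; exists s; rewrite ?sum_pre ?hwt.
(* The preimage of a set containing [r] contains [B], which has two vertices, so it cannot be the
   exceptional singleton. *)
have rC : r \notin C.
  apply: contraL B2 => rC; rewrite -leqNgt -(cards1 v0) -eC.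
  apply/subset_leq_card/subsetP => p pB.
  by rewrite inE /pi pB rC (subsetP sBA).
have {}eC : C = [set v0] by rewrite -eC pre_notin.
right; split=> //.
have := sum_pre t [set v0]; rewrite big_set1 => ->; rewrite pre_notin -?eC // eC.
by rewrite big_set1.
Qed.

Lemma fiber_r (R : nmodType) (F : T -> R) :
  (\sum_(p in A | pi p == r) F p = \sum_(p in B) F p)%R.
Proof.
apply: eq_bigl => p; rewrite /pi; case: (boolP (p \in B)) => pB.
  by rewrite (subsetP sBA) // eqxx.
by apply/negbTE; apply: contra pB => /andP[_ /eqP->].
Qed.

Lemma fiber_D (R : nmodType) (F : T -> R) u : u \in A :\: B ->
  (\sum_(p in A | pi p == u) F p = F u)%R.
Proof.
rewrite inE => /andP[uB uA]; rewrite (eq_bigl (pred1 u)) ?big_pred1_eq // => p /=.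
rewrite /pi; case: (boolP (p \in B)) => pB.
  have -> : (p == u) = false by apply: contraNF uB => /eqP <-.
  by rewrite andbC; case: eqP uB => // <-; rewrite rB.
by case: eqP => [->|]; rewrite ?uA ?andbF.
Qed.

(** Orienting the contraction fixes the directions of the edges leaving [B]. These edges then act as
    root arcs for [B], which is oriented second, and the two orientations are glued. *)
Lemma orientable_contract w o i t v0 :
  (forall A' w' o' i' t' v', #|A'| < #|A| -> certified A' w' o' i' t' v' ->
     orientable A' w' (fun u => t' u - (i' u)%:Z + (o' u)%:Z)%R) ->
  certified A w o i t v0 -> 1 < #|B| -> B != A ->
  slack 0 A w o i t B -> ~ slack 2 A w o i t B ->
  orientable A w (fun u => t u - (i u)%:Z + (o u)%:Z)%R.
Proof.
move=> IH cert B2 BA sl0 sl2; have [sym diag par tot hmin hmax hcut] := cert.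
have [s [hs sm hwB]] := slack_dichotomy cert sBA sl0 sl2.
set D := A :\: B.
have ltBA : #|B| < #|A| by rewrite proper_card // properEneq BA.
have rD : r \notin D by rewrite inE rB.
have lt1 : #|A1| < #|A|.
  by rewrite cardsU1 rD cardsD (setIidPr sBA); lia.
have [x1 hx1 hn1] := IH _ _ _ _ _ _ lt1 (certified_contract B2 cert).
have rA1 : r \in A1 by rewrite !inE eqxx.
have DA1 u : u \in D -> u \in A1 by move=> uD; rewrite in_setU1 uD orbT.
have Dr u : u \in D -> u != r by move=> uD; apply: contraNneq rD => <-.
have xr u : u \in D -> x1 u r + x1 r u = \sum_(q in B) w u q.
  move=> uD; rewrite (hx1 _ _ (DA1 _ uD) rA1 (Dr _ uD)) /contract_w (negbTE (Dr _ uD)).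
  by rewrite fiber_D // fiber_r.
(* The contraction only tells how many edges go from [u] into [B]; [y u q] decides how many of them
   end at [q]. *)
have [y hy] : exists y : T -> T -> nat, forall u, u \in D ->
    (forall q, y u q <= w u q) /\ \sum_(q in B) y u q = x1 u r.
  have : forall u, exists y : T -> nat, u \in D ->
      (forall q, y q <= w u q) /\ \sum_(q in B) y q = x1 u r.
    move=> u; case: (boolP (u \in D)) => [uD|]; last by exists (fun=> 0).
    by have [|y yw <-] := @distribute B (w u) (x1 u r); [rewrite -xr // leq_addr | exists y].
  by case/boolp.choice=> y hy; exists y.
have yle u q : u \in D -> y u q <= w u q by move=> /hy[].
have ysum u : u \in D -> \sum_(q in B) y u q = x1 u r by move=> /hy[].
have zsum u : u \in D -> \sum_(q in B) (w u q - y u q) = x1 r u.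
  move=> uD; have := xr _ uD; rewrite -ysum //.
  have -> : \sum_(q in B) w u q = \sum_(q in B) y u q + \sum_(q in B) (w u q - y u q).
    by rewrite -big_split; apply: eq_bigr => q _; rewrite /= subnKC // yle.
  by lia.
pose o2 q := o q + \sum_(u in D) y u q.
pose i2 q := i q + \sum_(u in D) (w u q - y u q).
have oi2 q : o2 q + i2 q = o q + i q + \sum_(u in D) w q u.
  have -> : \sum_(u in D) w q u = \sum_(u in D) y u q + \sum_(u in D) (w u q - y u q).
    by rewrite -big_split; apply: eq_bigr => u uD; rewrite /= subnKC ?yle // sym.
  by rewrite /o2 /i2; lia.
have sumA (F : T -> nat) : \sum_(v in A) F v = \sum_(v in B) F v + \sum_(v in D) F v.
  by rewrite (big_setID B) /= (setIidPr sBA).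
have hw2 C : C \subset B -> weight B w o2 i2 C = weight A w o i C.
  move=> sCB; rewrite /weight; under [in LHS]eq_bigr do rewrite oi2.
  rewrite [in LHS]big_split /= addnCA [RHS]addnC; congr addn; rewrite /cut -big_split.
  apply: eq_bigr => q qC /=; rewrite [RHS](big_setID B) /=; congr addn; apply: eq_bigl => v.
    by rewrite !inE; case: (boolP (v \in B)) => [/(subsetP sBA)->|]; rewrite ?andbF ?andbT.
  rewrite !inE; case: (boolP (v \in B)) => //= vB.
  by rewrite (contraNN (subsetP sCB v)).
have O2 : \sum_(q in B) o2 q = \sum_(q in B) o q + \sum_(u in D) x1 u r.
  rewrite big_split /= exchange_big; congr addn; apply: eq_bigr => u; exact: ysum.
have I2 : \sum_(q in B) i2 q = \sum_(q in B) i q + \sum_(u in D) x1 r u.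
  rewrite big_split /= exchange_big; congr addn; apply: eq_bigr => u; exact: zsum.
have net_r : netflow A1 x1 r =
    ((\sum_(u in D) x1 r u)%N%:Z - (\sum_(u in D) x1 u r)%N%:Z)%R.
  by rewrite /netflow big_setU1 //= subrr add0r sumrB !sum_Posz.
(* The net outflow prescribed at [r] in the contraction is the total condition for [B] with its new
   root. *)
have tot2 : cong (\sum_(q in B) t q + (\sum_(q in B) o2 q)%N%:Z)%R (\sum_(q in B) i2 q)%N%:Z.
  have fr (F : T -> nat) : \sum_(p in A | pi p == r) F p = \sum_(p in B) F p.
    exact: fiber_r.
  have [j] := hn1 _ rA1; rewrite net_r !fr.
  have -> : (\sum_(p in A | pi p == r) t p = \sum_(p in B) t p)%R by exact: fiber_r.
  move=> hj; exists (- j)%R; rewrite O2 I2; lia.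
have OI2 : \sum_(q in B) o2 q + \sum_(q in B) i2 q = weight A w o i B.
  rewrite -hw2 // -big_split /weight; suff -> : cut B w B = 0 by [].
  by rewrite /cut setDv big1 // => q _; rewrite big_set0.
(* The new root has exactly [weight A w o i B] arcs; tightness of [B] is what makes it
   admissible. *)
have [min2 max2] : minn (\sum_(q in B) o2 q) (\sum_(q in B) i2 q) < m /\
    maxn (\sum_(q in B) o2 q) (\sum_(q in B) i2 q) < 2 * m.
  apply: root_tight sm _ _; first by rewrite OI2.
  by case: tot2 hs => [j hj] [j' hj']; exists (j - j')%R; lia.
have cert2 : certified B w o2 i2 t v0.
  split=> //.
  - move=> q qB; have [j hj] := par _ (subsetP sBA _ qB); exists j; rewrite -hj.
    by congr (_ + Posz _)%R; rewrite -addnA oi2 sumA; lia.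
  - move=> C sCB C0 CB; have sCA := subset_trans sCB sBA.
    have CA : C != A by apply: contraNneq BA => e; rewrite eqEsubset sBA -e.
    by case: (hcut _ sCA C0 CA) => [[s' h1 h2]|]; [left; exists s'; rewrite ?hw2 | right].
have [x2 hx2 hn2] := IH _ _ _ _ _ _ ltBA cert2.
pose x u v := if u \in B then if v \in B then x2 u v else w v u - y v u
              else if v \in B then y u v else x1 u v.
have netA u : netflow A x u = (\sum_(v in B) ((x u v)%:Z - (x v u)%:Z)
     + \sum_(v in D) ((x u v)%:Z - (x v u)%:Z))%R.
  by rewrite /netflow (big_setID B) /= (setIidPr sBA).
have inD u : u \in A -> u \notin B -> u \in D by move=> uA uB; rewrite inE uA uB.
exists x => [u v uA vA uv|u uA].
  rewrite /x; case: (boolP (u \in B)) => uB; case: (boolP (v \in B)) => vB.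
  - exact: hx2.
  - by rewrite subnK ?yle ?inD // sym.
  - by rewrite subnKC // yle // inD.
  - rewrite hx1 ?DA1 ?inD // /contract_w (negbTE uv).
    by rewrite !fiber_D ?inD.
rewrite netA /x; case: (boolP (u \in B)) => uB.
  under eq_bigr => v vB do rewrite vB.
  have -> : (\sum_(v in D) ((if v \in B then x2 u v else (w v u - y v u)%N)%:Z -
        (if v \in B then x2 v u else y v u)%:Z) =
      (\sum_(v in D) (w v u - y v u))%N%:Z - (\sum_(v in D) y v u)%N%:Z)%R.
    rewrite -!sum_Posz -sumrB; apply: eq_bigr => v; rewrite inE => /andP[/negbTE-> _] //.
  have [j hj] := hn2 _ uB; exists j; move: hj; rewrite /netflow /i2 /o2 => ->.
  by lia.
have uD := inD _ uA uB.
have -> : (\sum_(v in B) ((if v \in B then y u v else x1 u v)%:Z -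
       (if v \in B then (w u v - y u v)%N else x1 v u)%:Z) =
    (x1 u r)%:Z - (x1 r u)%:Z)%R.
  by rewrite -ysum // -zsum // -!sum_Posz -sumrB; apply: eq_bigr => v ->.
have -> : (\sum_(v in D) ((if v \in B then y u v else x1 u v)%:Z -
       (if v \in B then (w u v - y u v)%N else x1 v u)%:Z) =
    \sum_(v in D) ((x1 u v)%:Z - (x1 v u)%:Z))%R.
  by apply: eq_bigr => v; rewrite inE => /andP[/negbTE-> _].
have [j] := hn1 _ (DA1 _ uD); rewrite /netflow big_setU1 // !fiber_D // => hj.
by exists j.
Qed.

End Contraction.

(** * Reductions in the absence of tight sets *)

(* Deleting one edge pays for fewer than [2m] new root arcs. *)
Definition potential A w o i :=
  m * (\sum_(u in A) \sum_(v in A) w u v)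
  + (\sum_(u in A) o u + \sum_(u in A) i u).

(** One step of the induction on [potential]: the vertex set stays fixed, while edges, root arcs,
    residues and the exceptional vertex may change. *)
Definition progress A w o i t : Prop :=
  (forall w' o' i' t' v', potential A w' o' i' < potential A w o i ->
     certified A w' o' i' t' v' ->
     orientable A w' (fun u => t' u - (i' u)%:Z + (o' u)%:Z)%R) ->
  orientable A w (fun u => t u - (i u)%:Z + (o u)%:Z)%R.

(** Single vertices are left out: they may be tight, and each reduction checks them separately. *)
Definition roomy A w o i t : Prop :=
  forall B, B \subset A -> 1 < #|B| -> B != A -> slack 2 A w o i t B.

Lemma weight_swap A w o i B : weight A w o i B = weight A w i o B.
Proof. by congr addn; apply: eq_bigr => u _; rewrite addnC. Qed.

Lemma sumzN B t : (\sum_(u in B) - t u = - \sum_(u in B) t u)%R.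
Proof. exact: sumrN. Qed.

Lemma slack_rev p A w o i t B : slack p A w o i t B ->
  slack p A w i o (fun u => - t u)%R B.
Proof.
case=> s [j hj] le; exists (- s)%R; last by rewrite weight_swap abszN.
by exists (- j)%R; rewrite sumzN hj; lia.
Qed.

Lemma certified_rev A w o i t v0 : certified A w o i t v0 ->
  certified A w i o (fun u => - t u)%R v0.
Proof.
move=> [sym diag par tot hmin hmax hcut]; split=> //.
- move=> u uA; have [j hj] := par u uA.
  by exists (j - t u)%R; lia.
- by case: tot => j hj; exists (- j)%R; rewrite sumzN; lia.
- by rewrite minnC.
- by rewrite maxnC.
- move=> B sB B0 BA; case: (hcut B sB B0 BA) => [/slack_rev|[-> [j hj]]]; first by left.
  by right; split=> //; exists (- j)%R; lia.
Qed.

Lemma roomy_rev A w o i t : roomy A w o i t -> roomy A w i o (fun u => - t u)%R.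
Proof. by move=> H B sB B2 BA; apply/slack_rev/H. Qed.

Lemma progress_rev A w o i t : (forall u v, w u v = w v u) ->
  progress A w i o (fun u => - t u)%R -> progress A w o i t.
Proof.
move=> sym H IH; apply: orientable_rev => //.
apply: orientable_ext (H _) => // [u|w' o' i' t' v' lt c].
  by exists 0%R; lia.
by apply: IH c; move: lt; rewrite /potential; lia.
Qed.

(** If no edge leaves [B], the weights of [B] and its complement add up to the number of root arcs,
    at most [3m - 2], whereas the two cut bounds ask for at least [4m - 2]. If the complement is the
    exceptional vertex, [B] carries the residue of the root and [root_bound] contradicts slack 2. *)
Lemma connected A w o i t v0 : certified A w o i t v0 -> 2 < #|A| ->
  roomy A w o i t ->
  forall B, B \subset A -> B != set0 -> B != A -> 0 < cut A w B.
Proof.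
move=> [sym diag par tot hmin hmax hcut] A3 room.
have main B : B \subset A -> B != A -> 1 < #|B| -> 0 < cut A w B.
  move=> sBA BA B2; rewrite lt0n; apply/eqP => cut0.
  have [s1 h1 le1] := room _ sBA B2 BA.
  have := weightC o i sym sBA; rewrite cut0 => hw.
  have sub : A :\: B \subset A by exact: subsetDl.
  have n0 : A :\: B != set0.
    by apply: contra BA; rewrite setD_eq0 => sAB; rewrite eqEsubset sBA.
  have nA : A :\: B != A.
    apply: contraTneq B2 => /setDidPl; rewrite disjoint_sym -setI_eq0 (setIidPl sBA).
    by move/eqP->; rewrite cards0.
  have [[s2 h2 le2]|[e t0]] := hcut _ sub n0 nA; first by move: hmin hmax; lia.
  have hs : cong s1 ((\sum_(u in A) i u)%:Z - (\sum_(u in A) o u)%:Z)%R.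
    have : (\sum_(u in A) t u = \sum_(u in B) t u + t v0)%R.
      by rewrite (big_setID B) /= (setIidPr sBA) e big_set1.
    case: tot h1 t0 => [j hj] [j1 hj1] [j0 hj0] hA.
    by exists (j - j1 - j0)%R; lia.
  by have := root_bound hmin hmax hs; lia.
move=> B sBA B0 BA; have [B2|B1] := ltnP 1 #|B|; first exact: main.
have -> : cut A w B = cut A w (A :\: B).
  rewrite /cut exchange_big /= setDDr setDv set0U (setIidPr sBA).
  by apply: eq_bigr => u _; apply: eq_bigr => v _; rewrite sym.
apply: main; first exact: subsetDl; last by rewrite cardsD (setIidPr sBA); lia.
apply: contra B0 => /eqP/setDidPl; rewrite disjoint_sym -setI_eq0.
by rewrite (setIidPl sBA).
Qed.

Lemma cut_gt0P A w B : 0 < cut A w B ->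
  exists u v, [/\ u \in B, v \in A, v \notin B & 0 < w u v].
Proof.
rewrite lt0n sum_nat_eq0 => /forall_inPn[u uB]; rewrite sum_nat_eq0.
case/forall_inPn=> v; rewrite inE => /andP[vB vA] wv.
by exists u, v; rewrite lt0n.
Qed.

Lemma del_edge w a c : (forall u v, w u v = w v u) -> (forall u, w u u = 0) ->
  0 < w a c -> exists w', [/\ forall u v, w u v = w' u v + edgew a c u v,
    forall u v, w' u v = w' v u & forall u, w' u u = 0].
Proof.
move=> sym diag wac; have ac : a != c by apply: contraTneq wac => ->; rewrite diag.
exists (fun u v => w u v - edgew a c u v); split=> [u v|u v|u].
- rewrite subnK // /edgew; have [->|ua] := eqVneq u a.
    by rewrite (negbTE ac) addn0; have [->|] := eqVneq v c.
  have [->|uc] := eqVneq u c; last by [].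
  by have [->|va] := eqVneq v a; rewrite //= sym.
- by rewrite sym edgew_sym.
- by rewrite diag.
Qed.

Lemma weight_edge A w w' o i a c B : a \in A -> c \in A -> B \subset A ->
  (forall u v, w u v = w' u v + edgew a c u v) ->
  weight A w o i B = weight A w' o i B + ((a \in B) (+) (c \in B)).
Proof.
move=> aA cA sB hw; rewrite /weight (eq_cut A B hw) cutD cut_edgew //; lia.
Qed.

Lemma degree_edge A w w' a c u : a \in A -> c \in A ->
  (forall u v, w u v = w' u v + edgew a c u v) ->
  \sum_(v in A) w u v = \sum_(v in A) w' u v + ((u == a) + (u == c)).
Proof.
by move=> aA cA hw; rewrite -(sum_edgew u aA cA) -big_split; apply: eq_bigr.
Qed.

Lemma total_edge A w w' a c : a \in A -> c \in A ->
  (forall u v, w u v = w' u v + edgew a c u v) ->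
  \sum_(u in A) \sum_(v in A) w u v = \sum_(u in A) \sum_(v in A) w' u v + 2.
Proof.
move=> aA cA hw; under eq_bigr do rewrite (degree_edge _ aA cA hw).
by rewrite big_split /= big_split /= !sum_eq_nat aA cA.
Qed.

Lemma subset_card1 B a : a \in B -> #|B| <= 1 -> B = [set a].
Proof.
move=> aB B1; apply/esym/eqP; rewrite eqEcard sub1set aB cards1.
by [].
Qed.

(** * Vertices of residue 0 *)

Lemma sum_move B (f : T -> nat) a c : 0 < f a ->
  \sum_(u in B) (f u + (u == c) - (u == a)) + (a \in B) =
  \sum_(u in B) f u + (c \in B).
Proof.
move=> fa; rewrite -!sum_eq_nat -!big_split; apply: eq_bigr => u _ /=.
rewrite subnK // addnC; case: eqP => [->|//]; lia.
Qed.

(** The path from the root through [v0] to [u] is replaced by a root arc to [u]. Residues do not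
    change, and only sets containing [v0] but not [u] lose weight, namely 2; the singleton of [v0]
    is exempt and the others have slack 2. *)
Lemma progress_zero_arc A w o i t v0 u : certified A w o i t v0 ->
  roomy A w o i t -> v0 \in A -> cong (t v0) 0 -> u \in A -> 0 < w v0 u ->
  0 < o v0 -> progress A w o i t.
Proof.
move=> [sym diag par tot hmin hmax hcut] room vA tv uA wu ov IH.
have [w' [hw sym' diag']] := del_edge sym diag wu.
pose o' v := o v + (v == u) - (v == v0).
have vu : v0 != u by apply: contraTneq wu => ->; rewrite diag.
have ho v : o' v + (v == v0) = o v + (v == u).
  by rewrite /o' subnK //; case: eqP => [->|//]; rewrite (leq_trans ov) ?leq_addr.
have so B : \sum_(v in B) o' v + (v0 \in B) = \sum_(v in B) o v + (u \in B).
  exact: sum_move.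
have soA : \sum_(v in A) o' v = \sum_(v in A) o v by have := so A; rewrite vA uA; lia.
apply: (orientable_del vA uA hw (b' := fun v => t v - (i v)%:Z + (o' v)%:Z)%R).
  by move=> v; have := ho v; abstract_bools; clear; lia.
apply: (IH _ _ _ _ v0); first by rewrite /potential soA (total_edge vA uA hw); lia.
split=> //; rewrite ?soA //.
- move=> v vA'; have [j hj] := par v vA'; exists (j - (v == v0 : nat)%:Z)%R.
  move: hj (ho v); rewrite (degree_edge _ vA uA hw); abstract_bools; clear; lia.
move=> B sB B0 BA.
have hwt : weight A w o i B + (u \in B) =
    weight A w' o' i B + ((v0 \in B) (+) (u \in B)) + (v0 \in B).
  rewrite (weight_edge o i vA uA sB hw) /weight !big_split /=.
  by have := so B; abstract_bools; clear; lia.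
have [vB|vB] := boolP (v0 \in B); have [uB|uB] := boolP (u \in B).
- case: (hcut B sB B0 BA) => [[s hs le]|]; [left; exists s => //|by right].
  by move: hwt le; rewrite vB uB /=; clear; lia.
- have [B2|B1] := ltnP 1 #|B|; last by right; rewrite (subset_card1 vB B1).
  left; have [s hs le] := room B sB B2 BA; exists s => //.
  by move: hwt le; rewrite vB (negbTE uB) /=; clear; lia.
- case: (hcut B sB B0 BA) => [[s hs le]|]; [left; exists s => //|by right].
  by move: hwt le; rewrite (negbTE vB) uB /=; clear; lia.
- case: (hcut B sB B0 BA) => [[s hs le]|]; [left; exists s => //|by right].
  by move: hwt le; rewrite (negbTE vB) (negbTE uB) /=; clear; lia.
Qed.

(** The edges from [v0] to [u] and [u'] are split off into an edge [uu']. Only sets separating [v0]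
    from both [u] and [u'] lose weight, namely 2. *)
Lemma progress_lift A w o i t v0 u u' : certified A w o i t v0 ->
  roomy A w o i t -> v0 \in A -> cong (t v0) 0 -> u \in A -> u' \in A -> u != u' ->
  0 < w v0 u -> 0 < w v0 u' -> progress A w o i t.
Proof.
move=> [sym diag par tot hmin hmax hcut] room vA tv uA u'A uu' wu wu' IH.
have vu : v0 != u by apply: contraTneq wu => ->; rewrite diag.
have vu' : v0 != u' by apply: contraTneq wu' => ->; rewrite diag.
have [w1 [hw1 sym1 diag1]] := del_edge sym diag wu.
have wu1 : 0 < w1 v0 u'.
  by move: wu'; rewrite hw1 /edgew (negbTE vu) [u' == u]eq_sym (negbTE uu') andbF !addn0.
have [w0 [hw0 sym0 diag0]] := del_edge sym1 diag1 wu1.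
pose w' p q := w0 p q + edgew u u' p q.
apply: (orientable_lift (w0 := w0) vA uA u'A) => //.
  by move=> p q; rewrite hw1 hw0 addnAC.
have hw' p q : w' p q = w0 p q + edgew u u' p q by [].
apply: (IH w' o i t v0).
  rewrite /potential (total_edge vA uA hw1) (total_edge vA u'A hw0).
  by rewrite (total_edge uA u'A hw'); lia.
split=> //.
- by move=> p q; rewrite !hw' sym0 edgew_sym.
- by move=> p; rewrite hw' diag0 /edgew; case: eqP => [->|]; rewrite ?(negbTE uu') //; case: eqP.
- move=> v vA'; have [j hj] := par v vA'; exists (j - (v == v0 : nat)%:Z)%R.
  move: hj; rewrite (degree_edge _ vA uA hw1) (degree_edge _ vA u'A hw0).
  by rewrite (degree_edge _ uA u'A hw'); abstract_bools; clear; lia.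
move=> B sB B0 BA.
have hwt : weight A w o i B + ((u \in B) (+) (u' \in B)) = weight A w' o i B
    + ((v0 \in B) (+) (u \in B)) + ((v0 \in B) (+) (u' \in B)).
  rewrite (weight_edge o i vA uA sB hw1) (weight_edge o i vA u'A sB hw0).
  by rewrite (weight_edge o i uA u'A sB hw'); abstract_bools; clear; lia.
have [B2|B1] := ltnP 1 #|B|.
  left; have [s hs le] := room B sB B2 BA; exists s => //; move: hwt le; clear.
  by case: (v0 \in B); case: (u \in B); case: (u' \in B) => /=; lia.
have [vB|vB] := boolP (v0 \in B); first by right; rewrite (subset_card1 vB B1).
case: (hcut B sB B0 BA) => [[s hs le]|]; [left; exists s => //|by right].
have : ~~ ((u \in B) && (u' \in B)).
  apply/andP => -[uB u'B]; move: uu'; have := subset_card1 uB B1 => eB.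
  by move: u'B; rewrite eB inE => /eqP->; rewrite eqxx.
move: hwt le; rewrite (negbTE vB); clear.
by case: (u \in B); case: (u' \in B) => //=; lia.
Qed.

(** Two parallel edges are oriented oppositely and deleted. The singleton of [u] loses 2 as well,
    whence the slack asked of it. *)
Lemma progress_double A w o i t v0 u : certified A w o i t v0 ->
  roomy A w o i t -> v0 \in A -> cong (t v0) 0 -> u \in A -> 1 < w v0 u ->
  slack 2 A w o i t [set u] -> progress A w o i t.
Proof.
move=> [sym diag par tot hmin hmax hcut] room vA tv uA wu slu IH.
have vu : v0 != u by apply: contraTneq wu => ->; rewrite diag.
have [w1 [hw1 sym1 diag1]] := del_edge sym diag (ltnW wu).
have wu1 : 0 < w1 u v0.
  by move: wu; rewrite hw1 /edgew !eqxx (negbTE vu) sym1; lia.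
have [w0 [hw0 sym0 diag0]] := del_edge sym1 diag1 wu1.
pose b v := (t v - (i v)%:Z + (o v)%:Z)%R.
apply: (orientable_del vA uA hw1 (b' := fun v => b v - (v == v0 : nat)%:Z + (v == u : nat)%:Z)%R).
  by move=> v; rewrite /b; lia.
apply: (orientable_del uA vA hw0 (b' := b)).
  by move=> v; rewrite /b; abstract_bools; clear; lia.
apply: (IH _ _ _ _ v0).
  by rewrite /potential (total_edge vA uA hw1) (total_edge uA vA hw0); lia.
split=> //.
  move=> v vA'; have [j hj] := par v vA'.
  exists (j - (v == v0 : nat)%:Z - (v == u : nat)%:Z)%R; move: hj.
  by rewrite (degree_edge _ vA uA hw1) (degree_edge _ uA vA hw0); abstract_bools; clear; lia.
move=> B sB B0 BA.
have hwt : weight A w o i B = weight A w0 o i B + 2 * ((v0 \in B) (+) (u \in B)).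
  rewrite (weight_edge o i vA uA sB hw1) (weight_edge o i uA vA sB hw0).
  by rewrite [(u \in B) (+) _]addbC; lia.
have [B2|B1] := ltnP 1 #|B|.
  left; have [s hs le] := room B sB B2 BA; exists s => //; move: hwt le; clear.
  by case: (_ (+) _) => /=; lia.
have [vB|vB] := boolP (v0 \in B); first by right; rewrite (subset_card1 vB B1).
have [uB|uB] := boolP (u \in B).
  left; have := slu; rewrite -(subset_card1 uB B1) => -[s hs le]; exists s => //.
  by move: hwt le; rewrite (negbTE vB) uB /=; clear; lia.
case: (hcut B sB B0 BA) => [[s hs le]|]; [left; exists s => //|by right].
by move: hwt le; rewrite (negbTE vB) (negbTE uB) /=; clear; lia.
Qed.

Lemma neighbor A w o i t v0 v : certified A w o i t v0 -> 2 < #|A| ->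
  roomy A w o i t -> v \in A -> exists2 u, u \in A & 0 < w v u.
Proof.
move=> cert A3 room vA.
have [|||u [u' [/set1P-> u'A _ wu]]] := cut_gt0P (connected cert A3 room _ _ _ (B := [set v])).
- by rewrite sub1set.
- by apply/set0Pn; exists v; rewrite inE.
- by apply: contraTneq A3 => <-; rewrite cards1.
by exists u'.
Qed.

Lemma progress_zero A w o i t v0 : certified A w o i t v0 -> 2 < #|A| ->
  roomy A w o i t -> v0 \in A -> cong (t v0) 0 -> progress A w o i t.
Proof.
move=> cert A3 room vA tv; have [sym diag par _ _ _ _] := cert.
have [u uA wu] := neighbor cert A3 room vA.
have [o0|] := posnP (o v0); last exact: progress_zero_arc cert room vA tv uA wu.
have [i0|] := posnP (i v0); last first.
  move=> i_gt0; apply: progress_rev => //.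
  apply: progress_zero_arc (certified_rev cert) (roomy_rev room) vA _ uA wu i_gt0.
  by case: tv => j ->; exists (- j)%R; lia.
case: (boolP [exists u' in A, (u' != u) && (0 < w v0 u')]).
  case/exists_inP=> u' u'A /andP[uu' wu'].
  by apply: progress_lift cert room vA tv u'A uA uu' wu' wu.
move=> /exists_inPn only.
have w0 u' : u' \in A -> u' != u -> w v0 u' = 0.
  by move=> u'A uu'; have := only _ u'A; rewrite uu' /= -leqNgt leqn0 => /eqP.
have deg : \sum_(v in A) w v0 v = w v0 u.
  by rewrite (bigD1 u) //= big1 ?addn0 // => v /andP[vA' /w0 ->].
(* With residue 0 and no root arcs, parity makes the degree of [v0] even. *)
have w2 : 1 < w v0 u.
  have [j hj] := par _ vA; have [j0 hj0] := tv.
  move: hj; rewrite deg o0 i0 hj0 => hj.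
  by have : w v0 u != 1; [apply/eqP => w1; move: hj; rewrite w1 | ]; lia.
apply: (progress_double cert room vA tv uA w2).
have vu : u != v0 by apply: contraTneq wu => ->; rewrite diag.
(* All edges leaving this pair leave from [u], and its residue is that of [u], so the singleton of
   [u] inherits slack 2. *)
have [|||s [j hj] le] := room [set u; v0].
- by apply/subsetP => p /set2P[]->.
- by rewrite cards2 vu.
- by apply: contraTneq A3 => <-; rewrite cards2 vu.
exists s.
  have [j0 hj0] := tv; move: hj; rewrite sum_set2 // big_set1 => hj.
  by exists (j - j0)%R; lia.
apply: leq_trans le _; rewrite leq_add2r /weight /cut !big_set1.
rewrite !big_setU1 ?inE //= !big_set1 o0 i0 !addn0 leq_add2r.
rewrite [X in _ + X]big1 ?addn0; last first.
  by move=> v; rewrite !inE negb_or -andbA => /and3P[uv _ vA']; rewrite w0.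
rewrite [X in _ <= X](big_setID [set v0]) /= setDDl.
exact: leq_addl.
Qed.

(** * Vertices of nonzero residue *)

Definition positive A w o i t v := exists s : int,
  [/\ (0 < s <= m%:Z)%R, cong (t v) s & `|s| + 2 * m <= weight A w o i [set v] + 2].

(** Defined by reversal, so that the two notions are exchanged by [progress_rev]. A vertex of
    residue [m] can be both. *)
Definition negative A w o i t v := positive A w i o (fun u => - t u)%R v.

Definition all_slack A w o i t : Prop :=
  forall B, B \subset A -> B != set0 -> B != A -> slack 0 A w o i t B.

(** The edge is directed from [a] to [c] and deleted: at both ends weight and distance to 0 drop by
    1 together. A larger set separating [a] from [c] loses one edge and its distance grows by at
    most 1, within its two spare edges. *)
Lemma progress_opposite A w o i t v0 a c : certified A w o i t v0 ->
  roomy A w o i t -> all_slack A w o i t -> a \in A -> c \in A -> 0 < w a c ->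
  positive A w o i t a -> negative A w o i t c -> progress A w o i t.
Proof.
move=> [sym diag par tot hmin hmax _] room hcut aA cA wac pa nc IH.
have [w' [hw sym' diag']] := del_edge sym diag wac.
pose t1 v := (t v + (v == a : nat)%:Z * -1)%R.
pose t' v := (t1 v + (v == c : nat)%:Z * 1)%R.
have st B : (\sum_(v in B) t' v = \sum_(v in B) t v
    + (a \in B : nat)%:Z * -1 + (c \in B : nat)%:Z * 1)%R.
  by rewrite (@sum_updz B t' t1 c 1) // (@sum_updz B t1 t a (-1)).
apply: (orientable_del aA cA hw (b' := fun v => t' v - (i v)%:Z + (o v)%:Z)%R).
  by move=> v; rewrite /t' /t1; abstract_bools; clear; lia.
apply: (IH w' o i t' v0); first by rewrite /potential (total_edge aA cA hw); lia.
split=> //.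
- move=> v vA; have [j hj] := par v vA; exists (j - (v == a : nat)%:Z)%R; move: hj.
  by rewrite (degree_edge _ aA cA hw) /t' /t1; abstract_bools; clear; lia.
- by case: tot => j hj; exists j; rewrite st aA cA; lia.
move=> B sB B0 BA; left.
have := weight_edge o i aA cA sB hw; have := st B.
have [aB|aB] := boolP (a \in B); have [cB|cB] := boolP (c \in B) => /= hst hwt.
- have [s [j hj] le] := hcut B sB B0 BA; exists s; last by move: le hwt; clear; lia.
  by exists j; rewrite hst hj; lia.
- have [B2|B1] := ltnP 1 #|B|.
    have [s [j hj] le] := room B sB B2 BA; exists (s - 1)%R; last first.
      by move: le hwt; clear; lia.
    by exists j; rewrite hst hj; lia.
  have eB := subset_card1 aB B1; case: pa; rewrite -eB => s [s0 [j hj] le].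
  exists (s - 1)%R; last by move: le hwt s0; clear; lia.
  by exists j; rewrite hst eB big_set1 hj; lia.
- have [B2|B1] := ltnP 1 #|B|.
    have [s [j hj] le] := room B sB B2 BA; exists (s + 1)%R; last first.
      by move: le hwt; clear; lia.
    by exists j; rewrite hst hj; lia.
  have eB := subset_card1 cB B1; case: nc; rewrite -eB weight_swap => s [s0 [j hj] le].
  exists (1 - s)%R; last by move: le hwt s0; clear; lia.
  by exists (- j)%R; rewrite hst eB big_set1; lia.
- have [s [j hj] le] := hcut B sB B0 BA; exists s; last by move: le hwt; clear; lia.
  by exists j; rewrite hst hj; lia.
Qed.

(** The same count as for an edge, with the root in the place of the negative end. *)
Lemma progress_unarc A w o i t v0 v : certified A w o i t v0 ->
  roomy A w o i t -> all_slack A w o i t -> v \in A ->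
  positive A w o i t v -> 0 < i v -> progress A w o i t.
Proof.
move=> [sym diag par tot hmin hmax _] room hcut vA pv iv IH.
pose i' u := i u - (u == v).
have hi u : i u = i' u + (u == v) * 1.
  by rewrite muln1 /i' subnK //; case: eqP => [->|].
have si B : \sum_(u in B) i u = \sum_(u in B) i' u + (v \in B).
  by rewrite (sum_upd B hi) muln1.
pose t' u := (t u + (u == v : nat)%:Z * -1)%R.
have st B : (\sum_(u in B) t' u = \sum_(u in B) t u + (v \in B : nat)%:Z * -1)%R.
  exact: sum_updz.
have siA : \sum_(u in A) i u = \sum_(u in A) i' u + 1 by rewrite si vA.
apply: (orientable_ext (w' := w) (b' := fun u => t' u - (i' u)%:Z + (o u)%:Z)%R) => //.
  by move=> u; exists 0%R; rewrite hi muln1 /t'; abstract_bools; clear; lia.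
apply: (IH w o i' t' v0); first by rewrite /potential siA; lia.
split=> //.
- move=> u uA; have [j hj] := par u uA; exists (j - (u == v : nat)%:Z)%R; move: hj.
  by rewrite hi muln1 /t'; abstract_bools; clear; lia.
- by case: tot => j hj; exists j; rewrite st vA; lia.
- by move: hmin; rewrite siA; lia.
- by move: hmax; rewrite siA; lia.
move=> B sB B0 BA; left.
have hwt : weight A w o i B = weight A w o i' B + (v \in B).
  by rewrite /weight !big_split /= si; abstract_bools; clear; lia.
move: hwt (st B); have [vB|vB] := boolP (v \in B) => /= hwt hst; last first.
  have [s [j hj] le] := hcut B sB B0 BA; exists s; last by move: le hwt; clear; lia.
  by exists j; rewrite hst hj; lia.
have [B2|B1] := ltnP 1 #|B|.
  have [s [j hj] le] := room B sB B2 BA; exists (s - 1)%R; last first.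
    by move: le hwt; clear; lia.
  by exists j; rewrite hst hj; lia.
have eB := subset_card1 vB B1; case: pv; rewrite -eB => s [s0 [j hj] le].
exists (s - 1)%R; last by move: le hwt s0; clear; lia.
by exists j; rewrite hst eB big_set1 hj; lia.
Qed.

(** Adding [k = m - s] arcs from [c] to the root brings the residue of [c] to [m], which also counts
    as negative, so an edge from [a] to [c] can be deleted. Since [k < m] and there were no arcs
    into the root, the root stays admissible, and the deleted edge outweighs the new arcs in
    [potential]. *)
Lemma progress_push A w o i t v0 a c (s : int) : certified A w o i t v0 ->
  roomy A w o i t -> all_slack A w o i t -> \sum_(u in A) i u = 0 ->
  a \in A -> c \in A -> 0 < w a c -> positive A w o i t a ->
  (0 < s < m%:Z)%R -> cong (t c) s -> `|s| + 2 * m <= weight A w o i [set c] + 2 ->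
  progress A w o i t.
Proof.
move=> [sym diag par tot hmin hmax _] room hcut i0 aA cA wac pa sm tc lec IH.
have [w' [hw sym' diag']] := del_edge sym diag wac.
pose k := `|(m%:Z - s)%R|.
have ks : (k%:Z = m%:Z - s)%R by rewrite /k; lia.
pose i' u := i u + (u == c) * k.
have si B : \sum_(u in B) i' u = \sum_(u in B) i u + (c \in B) * k by exact: sum_upd.
pose t1 v := (t v + (v == a : nat)%:Z * -1)%R.
pose t' v := (t1 v + (v == c : nat)%:Z * (k%:Z + 1))%R.
have st B : (\sum_(v in B) t' v = \sum_(v in B) t v
    + (a \in B : nat)%:Z * -1 + (c \in B : nat)%:Z * (k%:Z + 1))%R.
  by rewrite (@sum_updz B t' t1 c (k%:Z + 1)%R) // (@sum_updz B t1 t a (-1)).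
have siA : \sum_(u in A) i' u = k by rewrite si cA i0 mul1n.
apply: (orientable_del aA cA hw (b' := fun v => t' v - (i' v)%:Z + (o v)%:Z)%R).
  by move=> v; rewrite /t' /t1 /i'; case: (v == c); case: (v == a) => /=; clear; lia.
apply: (IH w' o i' t' v0).
  by rewrite /potential (total_edge aA cA hw) siA i0; move: sm ks; clear; lia.
split=> //.
- move=> v vA; have [j hj] := par v vA.
  exists (j - (v == a : nat)%:Z + (v == c : nat)%:Z * k%:Z)%R; move: hj.
  rewrite (degree_edge _ aA cA hw) /t' /t1 /i'.
  by case: (v == c); case: (v == a) => /=; clear; lia.
- by case: tot => j hj; exists j; rewrite st siA aA cA; move: hj; rewrite i0; clear; lia.
- by rewrite siA; move: sm ks hmin; clear; lia.
- by rewrite siA; move: sm ks hmax; clear; lia.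
move=> B sB B0 BA; left.
have hwt : weight A w o i B + (c \in B) * k =
    weight A w' o i' B + ((a \in B) (+) (c \in B)).
  rewrite (weight_edge o i aA cA sB hw) /weight.
  rewrite (@sum_upd B (fun u => o u + i' u) (fun u => o u + i u) c k) => [|u].
    by lia.
  by rewrite /i' addnA.
move: hwt (st B).
have [aB|aB] := boolP (a \in B); have [cB|cB] := boolP (c \in B) => /= hwt hst.
- have [s' [j hj] le] := hcut B sB B0 BA; exists (s' + k%:Z)%R; last first.
    by move: le hwt; clear; lia.
  by exists j; rewrite hst hj; lia.
- have [B2|B1] := ltnP 1 #|B|.
    have [s' [j hj] le] := room B sB B2 BA; exists (s' - 1)%R; last first.
      by move: le hwt; clear; lia.
    by exists j; rewrite hst hj; lia.
  have eB := subset_card1 aB B1; case: pa; rewrite -eB => s' [s0 [j hj] le].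
  exists (s' - 1)%R; last by move: le hwt s0; clear; lia.
  by exists j; rewrite hst eB big_set1 hj; lia.
- have [B2|B1] := ltnP 1 #|B|.
    have [s' [j hj] le] := room B sB B2 BA; exists (s' + k%:Z + 1)%R; last first.
      by move: le hwt; clear; lia.
    by exists j; rewrite hst hj; lia.
  have eB := subset_card1 cB B1; move: lec; rewrite -eB => lec.
  (* [t' c] has residue [m + 1], that is [-(m - 1)]. *)
  exists (1 - m%:Z)%R; last by move: lec hwt sm ks; clear; lia.
  by case: tc => j hj; exists (j + 1)%R; rewrite hst eB big_set1 hj; lia.
- have [s' [j hj] le] := hcut B sB B0 BA; exists s'; last by move: le hwt; clear; lia.
  by exists j; rewrite hst hj; lia.
Qed.

Lemma cong_small (z s : int) : cong z s ->
  exists s', [/\ cong z s', (`|s'| <= m)%N & (`|s'| <= `|s|)%N].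
Proof.
move=> zs; have [sm|sm] := leqP `|s| m; first by exists s.
have M0 : ((2 * m)%:Z != 0)%R by lia.
have r0 := modz_ge0 s M0; have rM := ltz_pmod s (_ : (0 < (2 * m)%:Z)%R).
have e := divz_eq s (2 * m)%:Z; set r := (s %% _)%Z in r0 rM e; set q := (s %/ _)%Z in e.
have {}rM : (r < (2 * m)%:Z)%R by apply: rM; lia.
have [rm|rm] := leqP `|r| m.
  exists r; split; [apply: cong_trans zs _; exists q|..]; lia.
by exists (r - (2 * m)%:Z)%R; split; [apply: cong_trans zs _; exists (q + 1)%R|..]; lia.
Qed.

(** If no edge joins a positive vertex to a negative one, connectedness makes all vertices positive
    and none negative. Then an arc into the root is deleted, or, if there is none, arcs are added at
    [v1]. *)
Lemma progress_signed A w o i t v0 v1 : certified A w o i t v0 -> 2 < #|A| ->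
  roomy A w o i t -> all_slack A w o i t ->
  {in A, forall v, positive A w o i t v \/ negative A w o i t v} ->
  v1 \in A -> positive A w o i t v1 -> progress A w o i t.
Proof.
move=> cert A3 room hcut sgn v1A pv1.
have [[a [c [aA cA wac pa nc]]]|noadj] := boolp.EM (exists a c, [/\ a \in A, c \in A,
    0 < w a c, positive A w o i t a & negative A w o i t c]).
  exact: progress_opposite cert room hcut aA cA wac pa nc.
have [sym diag _ _ _ _ _] := cert.
pose P := [set v in A | boolp.asbool (positive A w o i t v)].
have inP v : v \in P -> positive A w o i t v by rewrite inE => /andP[_ /boolp.asboolP].
have sPA : P \subset A by apply/subsetP => v; rewrite inE => /andP[].
have PA : P = A.
  apply/eqP; apply: contra_notT noadj => PA.
  have P0 : P != set0 by apply/set0Pn; exists v1; rewrite inE v1A; apply/boolp.asboolP.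
  have [u [v [uP vA vP wuv]]] := cut_gt0P (connected cert A3 room sPA P0 PA).
  exists u, v; split=> //; [exact: (subsetP sPA) | exact: inP |].
  case: (sgn v vA) => // pv; case/negP: vP.
  by rewrite inE vA; apply/boolp.asboolP.
have pos v : v \in A -> positive A w o i t v by rewrite -{1}PA; apply: inP.
have noneg v : v \in A -> ~ negative A w o i t v.
  move=> vA nv; apply: noadj; have [u uA wu] := neighbor cert A3 room vA.
  by exists u, v; split=> //; [rewrite sym | exact: pos].
have [/exists_inP[v vA iv]|/exists_inPn i0] := boolP [exists v in A, 0 < i v].
  exact: progress_unarc cert room hcut vA (pos v vA) iv.
have I0 : \sum_(u in A) i u = 0.
  by rewrite big1 // => u /i0; rewrite -leqNgt leqn0 => /eqP.
have [u uA wu] := neighbor cert A3 room v1A.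
have [s [s0 hs le]] := pv1.
apply: (progress_push (a := u) (c := v1) (s := s) cert) => //.
- by rewrite sym.
- exact: pos.
(* A residue equal to [m] would make [v1] negative too. *)
case/andP: s0 => -> /=; rewrite le_eqVlt => /orP[/eqP sm|//].
case: (noneg v1 v1A); exists (Posz m); split; [|case: hs => j hj; exists (- j - 1)%R|].
- by lia.
- by lia.
- by rewrite weight_swap -sm.
Qed.

Lemma progress_roomy A w o i t v0 : certified A w o i t v0 -> 2 < #|A| ->
  roomy A w o i t -> progress A w o i t.
Proof.
move=> cert A3 room; have [sym diag par tot hmin hmax hcut] := cert.
have [[vA tv]|nv] := boolp.EM (v0 \in A /\ cong (t v0) 0).
  exact: progress_zero cert A3 room vA tv.
have hall : all_slack A w o i t.
  move=> B sB B0 BA; case: (hcut B sB B0 BA) => // -[eB tv]; case: nv; split=> //.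
  by move: sB; rewrite eB sub1set.
(* As all cuts have slack, any vertex of residue 0 can take over the role of [v0]. *)
have [[v vA tv]|nz] := boolp.EM (exists2 v, v \in A & cong (t v) 0).
  apply: (progress_zero (v0 := v)) => //; split=> // B sB B0 BA.
  by left; apply: hall.
have sgn : {in A, forall v, positive A w o i t v \/ negative A w o i t v}.
  move=> v vA; have [|||s hs le] := hall [set v].
  - by rewrite sub1set.
  - by apply/set0Pn; exists v; rewrite inE.
  - by apply: contraTneq A3 => <-; rewrite cards1.
  move: hs; rewrite big_set1 => /cong_small[s' [hs' sm ss]].
  have s0 : (s' != 0)%R.
    by apply: contra_not_neq nz => s0; exists v; rewrite // -s0.
  have [sp|sn] : (0 < s' \/ s' < 0)%R by lia.
    by left; exists s'; split=> //; lia.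
  right; exists (- s')%R; split; [lia | | by rewrite weight_swap; lia].
  by case: hs' => j hj; exists (- j)%R; lia.
have /card_gt0P[v1 v1A] : 0 < #|A| by apply: leq_trans A3.
case: (sgn v1 v1A) => pv1; first exact: progress_signed cert A3 room hall sgn v1A pv1.
apply: progress_rev => //.
apply: (progress_signed (certified_rev cert) A3 (roomy_rev room) _ _ v1A pv1).
  by move=> B sB B0 BA; apply/slack_rev/hall.
move=> v vA; case: (sgn v vA) => [[s [s0 [j hj] le]]|]; [right | by left].
by exists s; split=> //; exists j; rewrite opprK.
Qed.

(** Nested induction: handling a tight set lowers the number of vertices with no control on
    [potential], and every other reduction keeps [A] and lowers [potential]. *)
Theorem certified_orientable A w o i t v0 : certified A w o i t v0 ->
  orientable A w (fun u => t u - (i u)%:Z + (o u)%:Z)%R.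
Proof.
have [n] := ubnP #|A|; elim: n A w o i t v0 => // n IHn A w o i t v0 ltAn.
have [p] := ubnP (potential A w o i).
elim: p w o i t v0 => // p IHp w o i t v0 ltp cert.
have [A2|A3] := leqP #|A| 2; first exact: orientable_small cert A2.
have [[B [sB B2 BA sl]]|noB] := boolp.EM (exists B, [/\ B \subset A, 1 < #|B|, B != A &
    ~ slack 2 A w o i t B]); last first.
  apply: (progress_roomy cert A3) => [B sB B2 BA|w' o' i' t' v' lt].
    by apply: boolp.contrapT => sl; apply: noB; exists B.
  by apply: IHp; apply: leq_trans lt _.
have /card_gt0P[r rB] : 0 < #|B| by apply: ltnW.
have B0 : B != set0 by apply/set0Pn; exists r.
apply: (orientable_contract sB rB _ cert B2 BA _ sl).
  by move=> A' w' o' i' t' v' ltA'; apply: IHn; apply: leq_trans ltA' _.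
case: (cert_cut cert sB B0 BA) => // -[eB _].
by move: B2; rewrite eB cards1.
Qed.

End ModuloOrientation.

(** * Orientations of signed graphs *)

Section GraphOrientation.

Variables (G : multigraph) (sigma : signature G).
Local Notation V := (vertex G).
Local Notation Ed := (edge G).

Definition is_positive (e : Ed) : bool := if sigma e is Positive then true else false.

Definition multiplicity (u v : V) := #|[set e : Ed | ends e == [set u; v]]|.

Definition positive_degree (v : V) := #|[set e : Ed | (v \in ends e) && is_positive e]|.

Lemma multiplicityE u v : multiplicity u v = \sum_e (ends e == [set u; v] : nat).
Proof.
by rewrite /multiplicity -sum1dep_card big_mkcond; apply: eq_bigr => e _; case: ifP.
Qed.

Lemma multiplicity_sym u v : multiplicity u v = multiplicity v u.
Proof. by rewrite /multiplicity setUC. Qed.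

Lemma multiplicity_diag u : multiplicity u u = 0.
Proof.
apply/eqP; rewrite cards_eq0; apply/eqP/setP => e; rewrite !inE.
by apply/eqP => ee; have := card_ends e; rewrite ee setUid cards1.
Qed.

Lemma edge_connected_cut l (B : {set V}) : edge_connected l G ->
  B != set0 -> B != [set: V] -> l <= cut [set: V] multiplicity B.
Proof.
move=> conn /set0Pn[u uB] BT.
have [v vB] : exists v, v \notin B.
  apply/existsP; apply: contraNT BT => /existsPn H; apply/eqP/setP => v.
  by rewrite inE; have := H v; rewrite negbK.
pose F := [set e : Ed | [exists p in B, exists q in ~: B, ends e == [set p; q]]].
have closedB : closed (adjacent_off F) B.
  move=> p q /existsP[e /andP[eF /eqP ee]].
  apply/idP/idP => [pB|qB]; apply: contraNT eF => nB; rewrite inE.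
    by apply/exists_inP; exists p => //; apply/exists_inP; exists q; rewrite ?inE // ee.
  by apply/exists_inP; exists q => //; apply/exists_inP; exists p; rewrite ?inE // ee setUC.
have : l <= #|F|.
  rewrite leqNgt; apply/negP => /conn/(_ u v) uv.
  by move: vB; rewrite -(closed_connect closedB uv) uB.
move/leq_trans; apply; rewrite /cut setTD.
have -> : \sum_(p in B) \sum_(q in ~: B) multiplicity p q =
    \sum_e \sum_(p in B) \sum_(q in ~: B) (ends e == [set p; q] : nat).
  rewrite [RHS]exchange_big; apply: eq_bigr => p _ /=; rewrite [RHS]exchange_big.
  by apply: eq_bigr => q _; rewrite multiplicityE.
rewrite -sum1_card big_mkcond; apply: leq_sum => e _; case: ifP => //.
rewrite inE => /exists_inP[p pB /exists_inP[q qB pq]].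
by rewrite (bigD1 p) //= (bigD1 q) //= pq.
Qed.

Lemma sum_positive_degree :
  \sum_(v in [set: V]) positive_degree v = 2 * #|[set e | is_positive e]|.
Proof.
under eq_bigr do rewrite /positive_degree -sum1dep_card big_mkcond /=.
rewrite exchange_big /= -sum1dep_card big_distrr /= [RHS]big_mkcond.
apply: eq_bigr => e _; case: (is_positive e); last by rewrite big1 // => v _; rewrite andbF.
rewrite muln1 -(card_ends e) -sum1_card [RHS]big_mkcond.
by apply: eq_big => v; rewrite ?inE // andbT.
Qed.

(** Every cut has residue 0 or [m], according to the parity of its positive degree sum, so weight
    [3m - 2] suffices. The [j] root arcs in each direction at a vertex cancel in its net outflow but
    add [2j] to its weight; [#|V| * j < m] keeps the root admissible. *)
Lemma modulo_orientation l c m j : edge_connected l G -> 1 < m -> ~~ odd m -> ~~ odd c ->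
  3 * m <= c * l + 2 * j + 2 -> #|V| * j < m ->
  orientable m [set: V] (fun u v => c * multiplicity u v)
    (fun v => Posz (m * positive_degree v)).
Proof.
move=> conn m1 evm evc hl hj.
have [V0|[v0 _]] := set_0Vmem [set: V].
  by exists (fun _ _ => 0) => [u|u]; rewrite V0 inE.
have sj : \sum_(u in [set: V]) j = #|V| * j by rewrite sum_nat_const cardsT.
suff cert : certified m [set: V] (fun u v => c * multiplicity u v)
    (fun=> j) (fun=> j) (fun v => Posz (m * positive_degree v)) v0.
  apply: orientable_ext (certified_orientable m1 cert) => // u.
  by exists 0%R; lia.
split.
- by move=> u v; rewrite multiplicity_sym.
- by move=> u; rewrite multiplicity_diag muln0.
- move=> u _; rewrite -big_distrr /=.
  have even n : ~~ odd n -> exists n', n = 2 * n'.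
    by move=> evn; exists n./2; rewrite mul2n even_halfK.
  have [[m' ->] [c' ->]] := (even m evm, even c evc).
  exists ((m' * positive_degree u + c' * \sum_(v in [set: V]) multiplicity u v + j)%N%:Z)%R.
  by move: (positive_degree u) (\sum_(v in _) _) => d S; lia.
(* By the handshake identity the prescribed outflows add up to a multiple of [2m]. *)
- exists (#|[set e | is_positive e]|%:Z)%R.
  by rewrite sum_Posz -big_distrr /= sum_positive_degree; lia.
- by rewrite sj minnn.
- by rewrite sj maxnn; lia.
move=> B _ B0 BT; left.
have hB := edge_connected_cut conn B0 BT.
have cB : cut [set: V] (fun u v => c * multiplicity u v) B =
    c * cut [set: V] multiplicity B.
  by rewrite /cut big_distrr; apply: eq_bigr => u _; rewrite big_distrr.
have jB : j <= \sum_(u in B) j.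
  by rewrite sum_nat_const leq_pmull // card_gt0.
pose n := \sum_(u in B) positive_degree u.
have tB : (\sum_(u in B) (m * positive_degree u)%:Z = (m * n)%:Z)%R.
  by rewrite sum_Posz big_distrr.
exists (Posz (odd n * m)).
  by exists (Posz n./2); rewrite tB -{1}(odd_double_half n) -mul2n; lia.
rewrite /weight cB !big_split /=.
have : c * l <= c * cut [set: V] multiplicity B by rewrite leq_mul2l hB orbT.
by case: (odd n); lia.
Qed.

End GraphOrientation.

(** * From modular flows to circular flows *)

Section IntegralFlow.

Variables (R : realType) (G : multigraph) (D : orientation G) (M : R).
Hypothesis M_gt0 : (0 < M)%R.
Local Notation V := (vertex G).
Local Notation Ed := (edge G).
Local Open Scope ring_scope.

Implicit Types (f g : Ed -> R) (n : V -> int) (a b : R).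

(** For [|a| < M] these are the representatives of [a] modulo [M] in the open interval from [-M] to
    [M]. *)
Definition flipped a b := [\/ b = a, 0 < a /\ b = a - M | a < 0 /\ b = a + M].

Lemma flipped_trans a b c : `|a| < M -> flipped a b -> flipped b c -> flipped a c.
Proof.
rewrite ltr_norml => /andP[aM aM'] [->|[a0 ->]|[a0 ->]] //.
- case=> [->|[b0 _]|[b0 ->]]; [exact: Or32 | by exfalso; lra |].
  by apply: Or31; lra.
- case=> [->|[b0 ->]|[b0 _]]; [exact: Or33 | | by exfalso; lra].
  by apply: Or31; lra.
Qed.

Lemma flipped_bound a b : `|a| < M -> flipped a b -> `|b| < M.
Proof.
rewrite ltr_norml => /andP[aM aM'] [->|[a0 ->]|[a0 ->]]; rewrite ltr_norml; apply/andP; split; lra.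
Qed.

Lemma boundary_upd f e0 d v :
  boundary D (fun e => f e + (e == e0)%:R * d) v =
  boundary D f v + ((arc_tail D e0 == v)%:R - (arc_head D e0 == v)%:R) * d.
Proof.
have S (p : pred Ed) : \sum_(e | p e) (f e + (e == e0)%:R * d) =
    \sum_(e | p e) f e + (p e0)%:R * d.
  rewrite big_split -mulr_suml; congr (_ + _ * _).
  case: (boolP (p e0)) => pe; last first.
    by rewrite big1 // => e pe'; case: eqP pe' pe => // -> ->.
  by rewrite (bigD1 e0) //= eqxx big1 ?addr0 // => e /andP[_ /negbTE->].
rewrite /boundary !S; lra.
Qed.

Lemma sum_boundary f (X : {set V}) : \sum_(v in X) boundary D f v =
  \sum_e ((arc_tail D e \in X)%:R - (arc_head D e \in X)%:R) * f e.
Proof.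
have S (h : Ed -> V) : \sum_(v in X) \sum_(e | h e == v) f e =
    \sum_e (h e \in X)%:R * f e.
  rewrite (exchange_big_dep xpredT) //=; apply: eq_bigr => e _.
  case: (boolP (h e \in X)) => hX.
    rewrite (bigD1 (h e)) /= ?hX ?eqxx // big1 ?addr0 ?mul1r // => v.
    by case/andP=> /andP[_ /eqP->]; rewrite eqxx.
  by rewrite mul0r big1 // => v /andP[vX /eqP hv]; rewrite hv vX in hX.
rewrite /boundary sumrB !S -sumrB; apply: eq_bigr => e _; lra.
Qed.

Definition pos_arc f (u v : V) := [exists e : Ed,
  [&& arc_tail D e == u, arc_head D e == v & 0 < f e] ||
  [&& arc_head D e == u, arc_tail D e == v & f e < 0]].

Lemma flip_path f u (p : seq V) : path (pos_arc f) u p -> uniq (u :: p) ->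
  exists g, [/\ forall e, flipped (f e) (g e),
    forall e, arc_tail D e \notin u :: p \/ arc_head D e \notin u :: p -> g e = f e &
    forall v, boundary D g v =
      boundary D f v - (u == v)%:R * M + (last u p == v)%:R * M].
Proof.
elim: p u => [|w p IHp] u /=.
  move=> _ _; exists f; split=> // [e|v]; [exact: Or31 | lra].
case/andP=> /existsP[e0 he0] hp /andP[uwp uniq_p].
have [g [fg gf bg]] := IHp _ hp uniq_p.
have ge0 : g e0 = f e0.
  by apply: gf; case/orP: he0 => /and3P[/eqP-> _ _]; [left | right].
pose d := if 0 < f e0 then - M else M.
have ends_e0 : forall v, ((arc_tail D e0 == v)%:R - (arc_head D e0 == v)%:R) * d =
    - (u == v)%:R * M + (w == v)%:R * M.
  move=> v; rewrite /d; case/orP: he0 => /and3P[/eqP-> /eqP-> fe0]; first by rewrite fe0; lra.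
  by rewrite ltNge (ltW fe0) /=; lra.
have uin : (arc_tail D e0 \in u :: w :: p) && (arc_head D e0 \in u :: w :: p).
  by case/orP: he0 => /and3P[/eqP-> /eqP-> _]; rewrite !inE !eqxx !orbT.
exists (fun e => g e + (e == e0)%:R * d); split.
- move=> e; have [->|_] := eqVneq e e0; last by rewrite mul0r addr0.
  rewrite mul1r ge0 /d; case/orP: he0 => /and3P[_ _ fe0].
    by rewrite fe0; apply: Or32.
  by rewrite ltNge (ltW fe0) /=; apply: Or33.
- move=> e he; have [ee|_] := eqVneq e e0.
    by move: uin he; rewrite ee => /andP[-> ->] [].
  rewrite mul0r addr0; apply: gf.
  by case: he; rewrite inE negb_or => /andP[_ he]; [left | right].
- move=> v; rewrite boundary_upd bg ends_e0; lra.
Qed.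

(** Induction on the total of [|n v|]: the flow leads from a vertex with [n > 0] to one with
    [n < 0], and flipping a path between them brings both values closer to 0. *)
Lemma integral_flow f n : (forall e, `|f e| < M) ->
  (forall v, boundary D f v = M * (n v)%:~R) ->
  exists2 g, forall e, flipped (f e) (g e) & forall v, boundary D g v = 0.
Proof.
have [N] := ubnP (\sum_v `|n v|)%N; elim: N f n => // N IHN f n ltN fM bf.
have [n0|/existsP[v0 nv0]] := boolP [forall v, n v == 0].
  exists f => [e|v]; first exact: Or31.
  by rewrite bf (eqP (forallP n0 v)) mulr0.
have sum0 : \sum_v n v = 0.
  have := sum_boundary f setT; rewrite [RHS]big1 => [|e _]; last by rewrite !inE subrr mul0r.
  under eq_bigl do rewrite inE.
  under eq_bigr do rewrite bf.
  rewrite -mulr_sumr -rmorph_sum /= => /eqP; rewrite mulf_eq0 (gt_eqF M_gt0) intr_eq0 /=.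
  by move/eqP.
have [p np] : exists p, 0 < n p.
  apply/existsP; apply: contraNT nv0 => /existsPn le0; apply/eqP/le_anti/andP; split.
    by rewrite leNgt.
  rewrite -sum0 (bigD1 v0) //= gerDl; apply: sumr_le0 => v _.
  by rewrite leNgt.
pose X := [set v | connect (pos_arc f) p v].
have [/exists_inP[q qX nq]|/exists_inPn X0] := boolP [exists q in X, n q < 0]; last first.
  (* No flow leaves the reachable set [X], so its total boundary cannot be positive. *)
  have : 0 < \sum_(v in X) boundary D f v.
    rewrite (bigD1 p) /=; last by rewrite inE connect0.
    rewrite ltr_wpDr ?bf ?mulr_gt0 ?ltr0z //; apply: sumr_ge0 => v /andP[vX _].
    by rewrite bf mulr_ge0 ?(ltW M_gt0) // ler0z leNgt X0.
  rewrite sum_boundary ltNge => /negP[]; apply: sumr_le0 => e _.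
  have step u v : u \in X -> pos_arc f u v -> v \in X.
    by rewrite !inE => pu uv; apply: connect_trans pu (connect1 uv).
  case: (boolP (arc_tail D e \in X)) => tX; case: (boolP (arc_head D e \in X)) => hX;
    rewrite ?subrr ?mul0r // ?subr0 ?mul1r ?sub0r ?mulN1r ?oppr_le0 leNgt.
    apply: contra hX => fe; apply: step tX _; apply/existsP; exists e.
    by rewrite !eqxx fe.
  apply: contra tX => fe; apply: step hX _; apply/existsP; exists e.
  by rewrite !eqxx fe orbT.
move: qX; rewrite inE => /connectP[s ps qs].
case/shortenP: ps qs => s' ps' us' _ q_last.
have [g [fg _ bg]] := flip_path ps' us'.
have pq : p != q by apply: contraTneq np => ->; rewrite -leNgt ltW.
pose n' v := n v - (p == v)%:R + (q == v)%:R.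
have [|e|v|h gh bh] := IHN g n'.
- move: ltN; rewrite ltnS; apply: leq_trans; rewrite (bigD1 p) //= [X in (_ <= X)%N](bigD1 p) //=.
  rewrite -addSn leq_add //; first by rewrite /n' eqxx eq_sym (negbTE pq); lia.
  apply: leq_sum => v vp; rewrite /n' eq_sym (negbTE vp).
  by case: eqP => [<-|_]; lia.
- exact: flipped_bound (fM e) (fg e).
- by rewrite bg bf /n' -q_last rmorphD rmorphB /= !rmorph_nat; ring.
exists h => // e; exact: flipped_trans (fM e) (fg e) (gh e).
Qed.

End IntegralFlow.

(** * Averaging over parallel edges and rescaling *)

Section CircularFlow.

Variables (R : realType) (G : multigraph) (sigma : signature G).
Local Notation V := (vertex G).
Local Notation Ed := (edge G).
Local Open Scope ring_scope.

Lemma card_set_sum (P : pred Ed) : #|[set e | P e]| = (\sum_e (P e : nat))%N.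
Proof. by rewrite -sum1dep_card big_mkcond; apply: eq_bigr => e _; case: ifP. Qed.

Lemma orientation_exists : exists D : orientation G, True.
Proof.
have /boolp.choice[p hp] (e : Ed) : exists p : V * V, ends e = [set p.1; p.2].
  by have /eqP/cards2P[u [v [_ ->]]] := card_ends e; exists (u, v).
by exists (Orientation hp).
Qed.

Variable D : orientation G.
Local Notation tl := (arc_tail D).
Local Notation hd := (arc_head D).

Lemma tail_neq_head e : tl e != hd e.
Proof. by have := card_ends e; rewrite (ends_orientation D) cards2; case: eqP. Qed.

Lemma boundaryD (f g : Ed -> R) v :
  boundary D (fun e => f e + g e) v = boundary D f v + boundary D g v.
Proof. by rewrite /boundary !big_split /=; lra. Qed.

Lemma boundaryZ (f : Ed -> R) a v :
  boundary D (fun e => f e * a) v = boundary D f v * a.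
Proof. by rewrite /boundary -!mulr_suml; lra. Qed.

Lemma ends_pair e u v : u != v -> (ends e == [set u; v] : nat) =
  ((tl e == u) && (hd e == v) + (hd e == u) && (tl e == v))%N.
Proof.
move=> uv; have th := tail_neq_head e; rewrite (ends_orientation D).
have [tu|tu] := eqVneq (tl e) u; have [hv|hv] := eqVneq (hd e) v => /=.
- by rewrite tu hv eqxx [v == u]eq_sym (negbTE uv).
- rewrite tu [_ == u]eq_sym -tu (negbTE th) /=.
  apply/eqP; rewrite eqb0; apply/eqP => /setP/(_ (hd e)).
  by rewrite !inE eqxx orbT (negbTE hv) eq_sym (negbTE th).
- rewrite hv [v == u]eq_sym (negbTE uv) /=.
  apply/eqP; rewrite eqb0; apply/eqP => /setP/(_ (tl e)).
  by rewrite !inE eqxx -hv (negbTE th) (negbTE tu).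
- have [hu|hu] := eqVneq (hd e) u; have [tv|tv] := eqVneq (tl e) v => /=.
  + by rewrite hu tv setUC eqxx.
  + apply/eqP; rewrite eqb0; apply/eqP => /setP/(_ (tl e)).
    by rewrite !inE eqxx (negbTE tv) (negbTE tu).
  + apply/eqP; rewrite eqb0; apply/eqP => /setP/(_ (hd e)).
    by rewrite !inE eqxx orbT (negbTE hv) (negbTE hu).
  + apply/eqP; rewrite eqb0; apply/eqP => /setP/(_ (hd e)).
    by rewrite !inE eqxx orbT (negbTE hv) (negbTE hu).
Qed.

(** A modular orientation is only known per pair of vertices; sharing [y] equally among the parallel
    edges keeps the boundary, and a real-valued flow may be fractional. *)
Lemma boundary_spread (y : V -> V -> R) v : (forall u w, y u w = - y w u) ->
  (forall u w, multiplicity u w = 0%N -> y u w = 0) ->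
  boundary D (fun e => y (tl e) (hd e) / (multiplicity (tl e) (hd e))%:R) v =
  \sum_u y v u.
Proof.
move=> anti y0; pose g u w := y u w / (multiplicity u w)%:R.
have ganti u w : g u w = - g w u by rewrite /g anti multiplicity_sym mulNr.
have out : \sum_(e | tl e == v) g (tl e) (hd e) =
    \sum_u \sum_e ((tl e == v) && (hd e == u))%:R * g v u.
  rewrite exchange_big big_mkcond; apply: eq_bigr => e _ /=.
  rewrite (bigD1 (hd e)) //= eqxx big1 => [|u]; last first.
    by rewrite eq_sym => /negbTE->; rewrite andbF mul0r.
  by case: eqP => [->|]; rewrite ?mul1r ?mul0r addr0.
have inn : \sum_(e | hd e == v) g (tl e) (hd e) =
    - \sum_u \sum_e ((hd e == v) && (tl e == u))%:R * g v u.
  rewrite exchange_big big_mkcond -sumrN; apply: eq_bigr => e _ /=.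
  rewrite (bigD1 (tl e)) //= eqxx big1 => [|u]; last first.
    by rewrite eq_sym => /negbTE->; rewrite andbF mul0r.
  by case: eqP => [->|]; rewrite ?mul1r ?mul0r addr0 ?oppr0 // ganti.
rewrite /boundary out inn opprK -big_split; apply: eq_bigr => u _ /=.
have [<-|uv] := eqVneq v u.
  have gv : g v v = 0 by have := ganti v v; lra.
  have yv : y v v = 0 by have := anti v v; lra.
  by rewrite gv yv !big1 ?addr0 // => e _; rewrite mulr0.
rewrite -!mulr_suml -mulrDl -big_split /=.
have -> : \sum_e (((tl e == v) && (hd e == u))%:R + ((hd e == v) && (tl e == u))%:R)
    = (multiplicity v u)%:R :> R.
  by rewrite multiplicityE natr_sum; apply: eq_bigr => e _; rewrite ends_pair // natrD.
rewrite /g; have [m0|m0] := eqVneq (multiplicity v u) 0%N.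
  by rewrite y0 // m0 mul0r.
by rewrite mulrC divfK // pnatr_eq0.
Qed.

Lemma positive_degreeE v : positive_degree sigma v =
  (#|[set e | (tl e == v) && is_positive sigma e]|
   + #|[set e | (hd e == v) && is_positive sigma e]|)%N.
Proof.
rewrite /positive_degree !card_set_sum -big_split.
apply: eq_bigr => e _ /=; rewrite (ends_orientation D) !inE ![v == _]eq_sym.
have th := tail_neq_head e.
have [tv|_] := eqVneq (tl e) v; have [hv|_] := eqVneq (hd e) v; rewrite ?addn0 //.
by rewrite tv hv eqxx in th.
Qed.

Lemma boundary_positive a v :
  boundary D (fun e => (is_positive sigma e)%:R * a) v =
  ((#|[set e | (tl e == v) && is_positive sigma e]|)%:R
   - (#|[set e | (hd e == v) && is_positive sigma e]|)%:R) * a :> R.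
Proof.
rewrite boundaryZ /boundary !card_set_sum !natr_sum; congr ((_ - _) * _).
  by rewrite big_mkcond; apply: eq_bigr => e _; case: eqP.
by rewrite big_mkcond; apply: eq_bigr => e _; case: eqP.
Qed.

(** The error [f1] has absolute value at most [c] because [c] copies were oriented per edge. Adding
    [m] on positive edges, flipping modulo [2m] and dividing by [m - c] gives the flow. *)
Lemma circular_flow_of_orientation (c m : nat) : (c < m)%N ->
  orientable m [set: V] (fun u v => c * multiplicity u v)%N
    (fun v => Posz (m * positive_degree sigma v)) ->
  exists f, circular_flow sigma (2 * m%:R / (m%:R - c%:R) : R) D f.
Proof.
move=> cm [x hx hn].
have xsum u v : u != v -> (x u v + x v u = c * multiplicity u v)%N.
  by move=> uv; apply: hx; rewrite ?inE.
pose y u v : R := (x u v)%:R - (x v u)%:R.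
pose f1 e := y (tl e) (hd e) / (multiplicity (tl e) (hd e))%:R.
pose f0 e := f1 e + (is_positive sigma e)%:R * m%:R.
have yanti u v : y u v = - y v u by rewrite /y opprB.
have f1c e : `|f1 e| <= c%:R.
  have mu : (0 < multiplicity (tl e) (hd e))%N.
    by apply/card_gt0P; exists e; rewrite inE -ends_orientation.
  rewrite normrM normfV normr_nat ler_pdivrMr ?ltr0n // -natrM.
  rewrite -(xsum _ _ (tail_neq_head e)) natrD /y ler_norml.
  have := ler0n R (x (tl e) (hd e)); have := ler0n R (x (hd e) (tl e)).
  by move=> ? ?; apply/andP; split; lra.
have bf1 v : boundary D f1 v = (netflow [set: V] x v)%:~R.
  rewrite boundary_spread // => [|u w uw]; last first.
    have [->|ne] := eqVneq u w; first by rewrite /y subrr.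
    have := xsum _ _ ne; rewrite uw muln0 => /eqP; rewrite addn_eq0 /y.
    by case/andP=> /eqP-> /eqP->; rewrite subrr.
  rewrite /netflow rmorph_sum /=; apply: eq_big => u; first by rewrite inE.
  by move=> _; rewrite rmorphB /= -!pmulrn.
have m0 : (0 < m%:R :> R) by rewrite ltr0n (leq_ltn_trans _ cm).
have cmR : (c%:R < m%:R :> R) by rewrite ltr_nat.
(* At [v] the errors contribute [m] times out-degree plus in-degree modulo [2m], the constants [m]
   times out-degree minus in-degree, both over positive edges: a multiple of [2m] in total. *)
have /boolp.choice[n hnn] v : exists n : int, boundary D f0 v = (2 * m%:R) * n%:~R.
  have [j hj] := hn v (in_setT v).
  exists (j + (#|[set e | (tl e == v) && is_positive sigma e]|)%:Z).
  rewrite boundaryD bf1 boundary_positive hj positive_degreeE.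
  rewrite !PoszM !PoszD !(rmorphD, rmorphM) /= -!pmulrn; ring.
have f0M e : `|f0 e| < 2 * m%:R.
  have := f1c e; rewrite /f0 ler_norml ltr_norml => /andP[? ?].
  by case: is_positive; rewrite ?mul1r ?mul0r; apply/andP; split; lra.
have M0 : 0 < 2 * m%:R :> R by lra.
have [g fg bg] := integral_flow M0 f0M hnn.
set q : R := m%:R - c%:R; have q0 : 0 < q by rewrite /q; lra.
have mq : m%:R = q + c%:R by rewrite /q; lra.
have qn0 : q != 0 by rewrite gt_eqF.
have q'0 : 0 < q^-1 by rewrite invr_gt0.
clearbody q.
have gM e := flipped_bound (f0M e) (fg e).
have normq e : `|g e / q| = `|g e| / q by rewrite normrM (gtr0_norm q'0).
exists (fun e => g e / q); split.
- by move=> e; rewrite -ltr_norml normq ltr_pM2r.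
(* The value lies between [m - c] and [m + c]; a flip by [2m] reflects this interval onto itself in
   absolute value. *)
- move=> e se; rewrite normq.
  have -> : 2 * m%:R / q - 1 = (m%:R + c%:R) / q by rewrite mq; field.
  rewrite ler_pdivlMr // mul1r ler_pM2r //.
  have := fg e; have := f1c e; rewrite /f0 /is_positive se mul1r ler_norml => /andP[? ?].
  case=> [->|[? ->]|[? _]]; last by exfalso; lra.
    by rewrite ler_norml ler_normr; apply/andP; split; [apply/orP; left | apply/andP; split]; lra.
  by rewrite ler_norml ler_normr; apply/andP; split; [apply/orP; right | apply/andP; split]; lra.
(* The absolute value is at most [c], or at least [2m - c] after a flip. *)
- move=> e se; rewrite normq mulr_ge0 ?normr_ge0 ?(ltW q'0) //=.
  have -> : 2 * m%:R / q / 2 - 1 = c%:R / q by rewrite mq; field.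
  have -> : 2 * m%:R / q / 2 + 1 = (2 * m%:R - c%:R) / q by rewrite mq; field.
  rewrite !ler_pM2r // ltr_pM2r //.
  have := fg e; have := f1c e; rewrite /f0 /is_positive se mul0r addr0 => fc.
  case=> [->|[? ge]|[? ge]]; first by left.
    right; rewrite gM andbT ge ler_normr; apply/orP; right.
    by move: fc; rewrite ler_norml => /andP[? ?]; lra.
  right; rewrite gM andbT ge ler_normr; apply/orP; left.
  by move: fc; rewrite ler_norml => /andP[? ?]; lra.
- by move=> v; rewrite boundaryZ bg mul0r.
Qed.

End CircularFlow.

(* Not imported earlier because [classical_sets] shadows lemmas of [finset]. *)
From mathcomp Require Import classical_sets constructive_ereal ereal.

(** * Bounds on the circular flow index *)

Lemma circular_flow_index_le (R : realType) (G : multigraph) (sigma : signature G)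
    (l c m j : nat) : edge_connected l G -> c < m -> 1 < m -> ~~ odd m -> ~~ odd c ->
  3 * m <= c * l + 2 * j + 2 -> #|vertex G| * j < m ->
  (circular_flow_index R sigma <= (2 * m%:R / (m%:R - c%:R) : R)%R%:E)%E.
Proof.
move=> conn cm m1 evm evc hl hj.
have [D _] := orientation_exists G.
have [f hf] := circular_flow_of_orientation R D cm
  (modulo_orientation sigma conn m1 evm evc hl hj).
apply: ereal_inf_lbound; exists (2 * m%:R / (m%:R - c%:R))%R => //; split; last by exists D, f.
have cmR : (c%:R < m%:R :> R)%R by rewrite ltr_nat.
have c0 : (0 <= c%:R :> R)%R by rewrite ler0n.
by rewrite ler_pdivlMr; lra.
Qed.

Theorem theorem5p14 (R : realType) (G : multigraph) (sigma : signature G)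
    (k : nat) (hk : (2 <= k)%N) :
  [/\ edge_connected (3 * k - 1)%N G ->
        (circular_flow_index R sigma <= ((2 * k%:R) / (k%:R - 1) : R)%R%:E)%E,
      edge_connected (3 * k)%N G ->
        (circular_flow_index R sigma < ((2 * k%:R) / (k%:R - 1) : R)%R%:E)%E
    & edge_connected (3 * k + 1)%N G ->
        (circular_flow_index R sigma
           <= ((4 * k%:R + 2) / (2 * k%:R - 1) : R)%R%:E)%E].
Proof.
have k2 : (2 <= k%:R :> R)%R by rewrite (ler_nat R 2).
split=> conn.
- have /le_trans : (circular_flow_index R sigma <=
      (2 * (2 * k)%:R / ((2 * k)%:R - 2%:R) : R)%R%:E)%E.
    by apply: (circular_flow_index_le _ _ (j := 0)) conn _ _ _ _ _ _; lia.
  apply; rewrite lee_fin natrM le_eqVlt; apply/orP; left; apply/eqP.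
  by field; rewrite ?subr_eq0; apply/andP; split; lra.
(* With [j = 2] the cut condition is the equality [3m = 3ck + 6], and [c] is even and large enough
   for [2 * #|vertex G| < m]. Strictness comes from [m > ck]. *)
- pose c := 2 * #|vertex G| + 2; pose m := c * k + 2.
  have /le_lt_trans : (circular_flow_index R sigma <=
      (2 * m%:R / (m%:R - c%:R) : R)%R%:E)%E.
    apply: (circular_flow_index_le _ _ (j := 2)) conn _ _ _ _ _ _; rewrite /m /c; nia.
  apply; rewrite lte_fin.
  have c0 : (0 < c%:R :> R)%R by rewrite ltr0n /c; lia.
  have mE : (m%:R = c%:R * k%:R + 2 :> R)%R by rewrite /m natrD natrM.
  have mc : (0 < m%:R - c%:R :> R)%R by nra.
  by rewrite ltr_pdivrMr // mulrAC ltr_pdivlMr; nra.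
- have /le_trans : (circular_flow_index R sigma <=
      (2 * (4 * k + 2)%:R / ((4 * k + 2)%:R - 4%:R) : R)%R%:E)%E.
    by apply: (circular_flow_index_le _ _ (j := 0)) conn _ _ _ _ _ _; lia.
  apply; rewrite lee_fin natrD natrM le_eqVlt; apply/orP; left; apply/eqP.
  by field; rewrite ?subr_eq0; apply/andP; split; lra.
Qed.
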